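(* Let $I\subseteq\mathbb{R}$ be a nonempty open interval, let $f:I\to\mathbb{R}$ be a strictly monotone and continuous function and let $p:I\to\mathbb{R}_+$ be a positive function. Then the following conditions are equivalent to each other: (i) The Bajraktarević mean $\mathscr{B}_{f,p}$ is Jensen convex. (ii) $f\in\mathcal{C}^{1\#}(I)$ and the mapping $B_{f,p}:I^2\to\mathbb{R}$ defined by $$B_{f,p}(x,u):=\frac{p(x)(f(x)-f(u))}{p(u)f'(u)}$$ is convex on $I^2$. (iii) $f\in\mathcal{C}^{2\#}(I)$, $p\in\mathcal{C}^1(I)$, and for all $x,y,u,v\in I$, $$\frac{p(y)(f(y)-f(v))}{p(v)f'(v)}\geq \frac{p(x)(f(x)-f(u))}{p(u)f'(u)}+\frac{(pf)'(x)-f(u)p'(x)}{(pf')(u)}(y-x)+p(x)\frac{(f(u)-f(x))\cdot (pf')'(u)-(pf')(u)\cdot f'(u)}{(pf')(u)^2}(v-u).$$ (iv) $f\in\mathcal{C}^{2\#}(I)$, $p\in\mathcal{C}^1(I)$, and for all $x,y,u,v\in I$, $$\bigg(\frac{(pf)'(x)-f(u)p'(x)}{(pf')(u)}-\frac{(pf)'(y)-f(v)p'(y)}{(pf')(v)}\bigg)(x-y)$$ $$+\bigg(p(x)\frac{(f(u)-f(x))\cdot (pf')'(u)-(pf')(u)\cdot f'(u)}{(pf')(u)^2}-p(y)\frac{(f(v)-f(y))\cdot (pf')'(v)-(pf')(v)\cdot f'(v)}{(pf')(v)^2}\bigg)(u-v)\geq0.$$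
   Context: $I$ is a nonempty open subinterval of $\mathbb{R}$ and $\mathbb{R}_+$ denotes the set of positive reals. $\mathcal{C}^k(I)$ denotes the space of $k$ times continuously differentiable real functions on $I$, and $\mathcal{C}^{k\#}(I)$ the set of those $k$ times continuously differentiable functions on $I$ whose first derivative is nonvanishing on $I$. Here $pf$ and $pf'$ denote pointwise products, so $(pf')(u)=p(u)f'(u)$, and $(pf')(u)^2$ is the square of this number. For a positive function $p:I\to\mathbb{R}_+$ and a continuous strictly monotone $f:I\to\mathbb{R}$, the Bajraktarević mean $\mathscr{B}_{f,p}:\bigcup_{n=1}^\infty I^n\to I$ is defined by $$\mathscr{B}_{f,p}(x_1,\dots,x_n):=f^{-1}\left(\frac{p(x_1)f(x_1)+\cdots+p(x_n)f(x_n)}{p(x_1)+\cdots+p(x_n)}\right).$$ A mean $M:\bigcup_{n=1}^\infty I^n\to I$ is said to be Jensen convex if, for all $n\in\mathbb{N}$ and all $x,y\in I^n$, $M\big(\frac{x+y}{2}\big)\leq\frac{M(x)+M(y)}{2}$. *)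

(* Defs.v *)
From mathcomp Require Import all_boot all_order all_algebra.
From mathcomp Require Import all_classical all_reals all_analysis.

Set Implicit Arguments.
Unset Strict Implicit.
Unset Printing Implicit Defensive.

Import Order.TTheory GRing.Theory Num.Theory.
Import numFieldNormedType.Exports.

Local Open Scope classical_set_scope.
Local Open Scope ring_scope.

(* Functions on I are encoded as total functions R -> R of which only the     *)
(* values on I matter; as I is open, this includes derivatives at points of I.*)

Definition Ck (R : realType) (I : set R) (k : nat) (f : R -> R) : Prop :=
  (forall j, (j < k)%N -> forall x, I x -> derivable (derive1n j f) x 1) /\
  {within I, continuous derive1n k f}.

Definition Ck_sharp (R : realType) (I : set R) (k : nat) (f : R -> R) : Prop :=
  Ck I k f /\ (forall x, I x -> derive1 f x != 0).

(* For f continuous and injective on the interval I, p positive on I, 0 < n   *)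
(* and coordinates in I, the argument of [pinv I f] lies in f @` I, so the    *)
(* default value of [pinv] is not used.                                       *)
Definition bajraktarevic_mean (R : realType) (I : set R) (f p : R -> R)
    (n : nat) (x : 'rV[R]_n) : R :=
  pinv I f ((\sum_(i < n) p (x ord0 i) * f (x ord0 i)) /
            (\sum_(i < n) p (x ord0 i))).

Definition jensen_convex_mean (R : realType) (I : set R)
    (M : forall n : nat, 'rV[R]_n -> R) : Prop :=
  forall (n : nat) (x y : 'rV[R]_n), (0 < n)%N ->
    (forall i, I (x ord0 i)) -> (forall i, I (y ord0 i)) ->
    M n (2^-1 *: (x + y)) <= (M n x + M n y) / 2.

Definition bajraktarevic_kernel (R : realType) (f p : R -> R) (x u : R) : R :=
  p x * (f x - f u) / (p u * derive1 f u).

(* Main.v *)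
Require Import Defs.
From mathcomp Require Import all_boot all_order all_algebra.
From mathcomp Require Import all_classical all_reals all_analysis.
From mathcomp Require Import ring lra.

(** Why the theorem holds.  Write K for the kernel of (ii).

    (iv) -> (i).  Along a segment of I x I, (iv) says that the derivative of K
    is nondecreasing, so by the mean value theorem K is midpoint convex
    ([gradient_monotone_jensen]).  The mean u of x_1, .., x_n is characterised
    by: the sum of the K (x_i) u vanishes.  Hence, if u and v are the means of
    x and y and w = (u + v) / 2, summing the midpoint inequalities shows that
    the sum of the K ((x_i + y_i) / 2) w is nonpositive, which says that the
    mean of (x + y) / 2 is at most w ([jensen_kernel_mean]).

    (ii) -> (iii).  For fixed u, the convex function z |-> K z u is p times a
    function of class C^1 which changes sign at u.  Near a point x0, two such
    sections with u on either side of x0 and their supporting lines enclose p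
    between two differentiable functions that agree at x0; so p is
    differentiable ([factor_derivable]).  A differentiable convex function is
    C^1, and so is its quotient by a C^1 function, whence p is C^1.  The same
    argument in the variable u makes 1 / (p f') a C^1 function, so f is C^2
    ([convex_kernel_smooth]), and (iii) is the tangent inequality of a
    differentiable convex function.  (iii) -> (iv) adds up two instances
    of (iii).

    (i) -> (ii) is the main part, since nothing is known of p and f' does not
    exist yet.  One may take f increasing.  Let M k x u be the mean of one
    copy of x and k copies of u; it tends to u, and k (M k x u - u) tends to
    K x u wherever f' u exists and is nonzero.  Each M k is midpoint convex and lies
    between its arguments, hence it is convex ([oam_convex]).  So it is
    continuous in x, and solving the equation of M 1 for p x shows that p is
    continuous.  For u < x, take L u := limsup_k k (M k x u - u).  It is
    finite and positive: otherwise, by midpoint convexity together with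
    M k w w = w, the same would fail at all points near u, and f would be
    constant or have infinite slope on an interval ([oam_bounded],
    [oam_bounded_below]).  As a limsup of convex functions L is convex,
    so continuous.  The steps M k x u - u show that f has arbitrarily short
    steps to the right of u whose slope is close to
    c u := p x (f x - f u) / (p u L u).  A continuous function having such
    steps for a continuous c has derivative c ([small_steps_derivative]).
    Now f is C^1 with nonvanishing derivative, and K, being the limit of
    the convex functions k (M k x u - u), is convex. *)

Import Order.TTheory GRing.Theory Num.Theory.
Import numFieldNormedType.Exports.

Local Open Scope classical_set_scope.
Local Open Scope ring_scope.

Set Implicit Arguments.
Unset Strict Implicit.

(** * Derivatives of real functions *)

(** The first-order expansion is the form of differentiability in which one can
    squeeze functions and sum up small steps. *)
Lemma is_derive_linear_approx (R : realType) (f : R -> R) (x m : R) :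
  is_derive x 1 f m <->
  forall e : R, 0 < e -> \forall z \near x, `|f z - f x - m * (z - x)| <= e * `|z - x|.
Proof.
rewrite is_derive1_caratheodory; split => [[g [fE cg <-]] e e0|fm].
  have /cvgrPdist_le/(_ _ e0) := cg; apply: filterS => z gz.
  by rewrite fE -mulrBl normrM ler_wpM2r// distrC.
exists (fun z => if z == x then m else (f z - f x) / (z - x)); split.
- move=> z; case: eqVneq => [->|zx]; first by rewrite !subrr mulr0.
  by rewrite divfK// subr_eq0.
- apply/cvgrPdist_le => e e0; move: (fm e e0); apply: filterS => z.
  rewrite eqxx; case: eqVneq => [->|zx] => [_|]; first by rewrite subrr normr0 ltW.
  have zx0 : z - x != 0 by rewrite subr_eq0.
  move=> h; rewrite distrC -(ler_pM2r (_ : 0 < `|z - x|)) ?normr_gt0//.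
  by rewrite -normrM mulrBl divfK.
- by rewrite eqxx.
Qed.

Lemma open_nbhs_itv (R : realType) (I : set R) (x : R) : open I -> I x ->
  exists2 e : R, 0 < e & forall z, `|z - x| <= e -> I z.
Proof.
move=> oI Ix.
have /nbhs_closedballP[e eI] : nbhs x I by exact: open_nbhs_nbhs.
exists e%:num => // z zx; apply: eI.
by rewrite closed_ballE// /closed_ball_/= distrC.
Qed.

Lemma near_dist (R : realType) (x e : R) : 0 < e ->
  \forall z \near x, `|z - x| <= e.
Proof.
by move=> e0; apply/nbhs_ballP; exists e => // z; rewrite /ball/= distrC => /ltW.
Qed.

Lemma nearP_dist (R : realType) (x : R) (P : R -> Prop) :
  (\forall z \near x, P z) <-> exists2 e : R, 0 < e & forall z, `|z - x| <= e -> P z.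
Proof.
split=> [/nbhs_closedballP[e eP]|[e e0 eP]]; last first.
  by move: (near_dist x e0); apply: filterS => z /eP.
exists e%:num => // z zx; apply: eP.
by rewrite closed_ballE// /closed_ball_/= distrC.
Qed.

(** At x the nonnegative difference of the two functions has a minimum. *)
Lemma touching_derivative (R : realType) (l h : R -> R) (x ml mh : R) :
  l x = h x -> (\forall z \near x, l z <= h z) ->
  is_derive x 1 l ml -> is_derive x 1 h mh -> ml = mh.
Proof.
move=> lh0 lh /is_derive_linear_approx dl /is_derive_linear_approx dh.
apply/eqP; rewrite -subr_eq0 -normr_le0; apply/ler_addgt0Pr => e e0.
rewrite add0r.
have e20 : 0 < e / 2 by lra.
have [d d0 dP] := (nearP_dist _ _).1
  (filterI (filterI lh (dl _ e20)) (dh _ e20)).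
have Ep : x + d - x = d by ring.
have Em : x - d - x = - d by ring.
have [[]] := dP (x + d) ltac:(by rewrite addrAC subrr add0r gtr0_norm).
have [[]] := dP (x - d) ltac:(by rewrite addrAC subrr add0r normrN gtr0_norm).
rewrite /= Ep Em normrN (gtr0_norm d0) lh0 !ler_norml => a1 /andP[a2 a3] /andP[a4 a5].
move=> b1 /andP[b2 b3] /andP[b4 b5].
apply/andP; split; nra.
Qed.

Lemma squeeze_derivative (R : realType) (l g h : R -> R) (x m : R) :
  l x = g x -> h x = g x -> (\forall z \near x, l z <= g z <= h z) ->
  is_derive x 1 l m -> is_derive x 1 h m -> is_derive x 1 g m.
Proof.
move=> lx hx lgh /is_derive_linear_approx dl /is_derive_linear_approx dh.
apply/is_derive_linear_approx => e e0.
near=> z; have /andP[a b] : l z <= g z <= h z by near: z.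
have u : `|l z - l x - m * (z - x)| <= e * `|z - x| by near: z; exact: dl.
have v : `|h z - h x - m * (z - x)| <= e * `|z - x| by near: z; exact: dh.
move: u v; rewrite lx hx !ler_norml => /andP[c _] /andP[_ d].
by apply/andP; split; lra.
Unshelve. all: by end_near. Qed.


(** * Convex functions on an interval *)

(** Convexity in division-free three-point form, which covers a = b as well and
    needs no convex-combination parameter. *)
Definition convex_on (R : realType) (I : set R) (f : R -> R) :=
  forall a z b, I a -> I b -> a <= z <= b ->
    (b - a) * f z <= (b - z) * f a + (z - a) * f b.

(** The Bernstein-Doetsch theorem.  Subtract the chord: the difference G is
    midpoint convex and vanishes at a and b.  Any point of [a, b] is the midpoint
    of its nearest endpoint and another point of [a, b], so sup G <= sup G / 2. *)
Lemma jensen_convex_on (R : realType) (I : set R) (f : R -> R) :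
  is_interval I ->
  (forall a b, I a -> I b -> f ((a + b) / 2) <= (f a + f b) / 2) ->
  (forall a b, I a -> I b -> exists C, forall z, a <= z <= b -> f z <= C) ->
  convex_on I f.
Proof.
move=> II Jf bf a z b Ia Ib /andP[az zb].
case: (eqVneq a b) => [ab|ab].
  by have -> : z = a; [lra|rewrite -ab; lra].
have {}ab : a < b by rewrite lt_neqAle ab (le_trans az).
pose L t := ((b - t) * f a + (t - a) * f b) / (b - a).
have ba0 : b - a != 0 by lra.
pose G t := f t - L t.
have LJ s t : L ((s + t) / 2) = (L s + L t) / 2 by rewrite /L; field.
have La : L a = f a by rewrite /L; field.
have Lb : L b = f b by rewrite /L; field.
have [C fC] := bf a b Ia Ib.
pose A := [set G t | t in `[a, b]%classic].
have inab t : a <= t -> t <= b -> `[a, b]%classic t by rewrite /= in_itv/= => -> ->.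
have hA : has_sup A.
  split; first by exists (G a); exists a => //; apply: inab; rewrite ?lexx ?ltW.
  exists (C + `|f a| + `|f b|) => _ [t + <-]; rewrite /= in_itv/= => /andP[ta tb].
  have := fC t; rewrite ta tb => /(_ erefl).
  suff : - L t <= `|f a| + `|f b| by rewrite /G; lra.
  have h1 := ler_norm (- f a); have h2 := ler_norm (- f b).
  have h3 := normr_ge0 (f a); have h4 := normr_ge0 (f b).
  rewrite !normrN in h1 h2.
  rewrite /L -mulNr ler_pdivrMr; last lra.
  nra.
have supA : forall t, a <= t -> t <= b -> G t <= sup A.
  move=> t ta tb; apply: sup_upper_bound => //; exists t => //; exact: inab.
have : sup A <= sup A / 2.
  apply: ge_sup; first by case: hA.
  move=> _ [t + <-]; rewrite /= in_itv/= => /andP[ta tb].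
  have It : I t by apply: (II a b) => //; rewrite ta.
  case: (leP t ((a + b) / 2)) => tm.
    have I2 : I (2 * t - a) by apply: (II a b) => //; apply/andP; split; lra.
    have := supA (2 * t - a) ltac:(lra) ltac:(lra).
    have := Jf a (2 * t - a) Ia I2; have := LJ a (2 * t - a).
    have -> : (a + (2 * t - a)) / 2 = t by field.
    by rewrite /G La; lra.
  have I2 : I (2 * t - b) by apply: (II a b) => //; apply/andP; split; lra.
  have := supA (2 * t - b) ltac:(lra) ltac:(lra).
  have := Jf b (2 * t - b) Ib I2; have := LJ b (2 * t - b).
  have -> : (b + (2 * t - b)) / 2 = t by field.
  by rewrite /G Lb; lra.
have := supA z az zb; rewrite /G /L => h1 h2.
have : f z <= ((b - z) * f a + (z - a) * f b) / (b - a) by lra.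
by rewrite ler_pdivlMr 1?mulrC//; lra.
Qed.

(** Comparison with the chords to x - e and x + e gives a Lipschitz bound at x. *)
Lemma convex_on_continuous (R : realType) (I : set R) (f : R -> R) :
  open I -> convex_on I f -> forall x, I x -> {for x, continuous f}.
Proof.
move=> oI cf x Ix; have [e e0 eI] := open_nbhs_itv oI Ix.
have Ir : I (x + e) by apply: eI; rewrite addrAC subrr add0r gtr0_norm.
have Il : I (x - e) by apply: eI; rewrite addrAC subrr add0r normrN gtr0_norm.
pose K := `|f (x + e) - f x| + `|f (x - e) - f x| + 1.
have h1 := ler_norm (f (x + e) - f x); have h2 := ler_norm (f (x - e) - f x).
have h3 := normr_ge0 (f (x + e) - f x); have h4 := normr_ge0 (f (x - e) - f x).
have K0 : 0 < K by rewrite /K; lra.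
apply/cvgrPdist_le => d d0.
have k0 : 0 < Num.min e (d * e / K) by rewrite lt_min e0 divr_gt0// mulr_gt0.
move: (near_dist x k0); apply: filterS => z; rewrite le_min => /andP[ze].
rewrite ler_pdivlMr// => zd.
have Iz : I z by exact: eI.
suff : e * `|f x - f z| <= `|z - x| * K.
  by move=> h; rewrite -(ler_pM2l e0); apply: (le_trans h); rewrite (mulrC e).
have [xz|zx] := leP x z.
  rewrite ger0_norm in ze *; last lra.
  have a1 := cf x z (x + e) Ix Ir ltac:(apply/andP; split; lra).
  have a2 := cf (x - e) x z Il Iz ltac:(apply/andP; split; lra).
  rewrite -{1}(gtr0_norm e0) -normrM ler_norml /K.
  by apply/andP; split; nra.
rewrite ltr0_norm in ze *; last lra.
have a1 := cf (x - e) z x Il Ix ltac:(apply/andP; split; lra).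
have a2 := cf z x (x + e) Iz Ir ltac:(apply/andP; split; lra).
rewrite -{1}(gtr0_norm e0) -normrM ler_norml /K.
by apply/andP; split; nra.
Qed.

(** The slope is the supremum of the slopes of the chords ending at x, which the
    chords starting at x bound from above. *)
Lemma convex_on_subgradient (R : realType) (I : set R) (f : R -> R) (x : R) :
  open I -> convex_on I f -> I x ->
  exists s, forall z, I z -> f x + s * (z - x) <= f z.
Proof.
move=> oI cf Ix; have [e e0 eI] := open_nbhs_itv oI Ix.
have Ir : I (x + e) by apply: eI; rewrite addrAC subrr add0r gtr0_norm.
have Il : I (x - e) by apply: eI; rewrite addrAC subrr add0r normrN gtr0_norm.
pose A := [set (f x - f z) / (x - z) | z in [set z | I z /\ z < x]].
have slopes z w : I z -> I w -> z < x -> x < w ->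
    (f x - f z) / (x - z) <= (f w - f x) / (w - x).
  move=> Iz Iw zx xw; have := cf z x w Iz Iw ltac:(apply/andP; split; lra).
  rewrite ler_pdivrMr; last lra.
  rewrite mulrAC ler_pdivlMr; last lra.
  by nra.
have A0 : A !=set0.
  by exists ((f x - f (x - e)) / (x - (x - e))); exists (x - e) => //; split => //; lra.
have hA : has_sup A.
  split=> //; exists ((f (x + e) - f x) / (x + e - x)) => _ [z [Iz zx] <-].
  by apply: slopes => //; lra.
exists (sup A) => z Iz; have [zx|xz|->] := ltgtP z x; last by lra.
  have : (f x - f z) / (x - z) <= sup A.
    by apply: sup_upper_bound => //; exists z.
  rewrite ler_pdivrMr; last lra.
  nra.
have : sup A <= (f z - f x) / (z - x).
  by apply: ge_sup => // _ [w [Iw wx] <-]; apply: slopes.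
rewrite ler_pdivlMr; last lra.
nra.
Qed.

Lemma is_derive_line (R : realType) (c s x0 x : R) :
  is_derive x 1 (fun z => c + s * (z - x0)) s.
Proof.
apply/is_derive_linear_approx => e e0; near=> z.
have -> : c + s * (z - x0) - (c + s * (x - x0)) - s * (z - x) = 0 by ring.
by rewrite normr0 mulr_ge0// ltW.
Unshelve. all: by end_near. Qed.

Lemma near_open_set (R : realType) (I : set R) (x : R) : open I -> I x ->
  \forall z \near x, I z.
Proof. by move=> oI Ix; apply: open_nbhs_nbhs. Qed.

Lemma convex_on_tangent (R : realType) (I : set R) (f : R -> R) (x z m : R) :
  open I -> convex_on I f -> I x -> I z -> is_derive x 1 f m ->
  f x + m * (z - x) <= f z.
Proof.
move=> oI cf Ix Iz dm; have [s sP] := convex_on_subgradient oI cf Ix.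
have <- : s = m.
  apply: (@touching_derivative _ (fun z => f x + s * (z - x)) f x) => //.
  - by lra.
  - by move: (near_open_set oI Ix); apply: filterS => w /sP.
  - exact: is_derive_line.
exact: sP.
Qed.

(** A chord from x to a nearby x + k has slope less than f' x + e, and by
    continuity of f so has the chord from z to x + k for z near x; the tangent at
    z lies below it, so f' z < f' x + e.  The chord to x - k bounds f' z from
    below. *)
Lemma convex_derive1_continuous (R : realType) (I : set R) (f : R -> R) :
  open I -> convex_on I f -> (forall x, I x -> derivable f x 1) ->
  forall x, I x -> {for x, continuous (derive1 f)}.
Proof.
move=> oI cf df x Ix.
have dfP z : I z -> is_derive z 1 f (derive1 f z).
  by move=> /df/derivableP; rewrite derive1E.
have fx : {for x, continuous f} := convex_on_continuous oI cf Ix.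
apply/cvgrPdist_le => e e0.
have e20 : 0 < e / 2 by lra.
have /nearP_dist[d d0 dP] := (is_derive_linear_approx _ _ _).1 (dfP x Ix) _ e20.
have [d' d'0 d'I] := open_nbhs_itv oI Ix.
(* A length at which the two chords at x have slope within e / 2 of f' x. *)
pose k := Num.min d d'.
have k0 : 0 < k by rewrite lt_min d0.
have Ir : I (x + k).
  by apply: d'I; rewrite addrAC subrr add0r gtr0_norm// ge_min lexx orbT.
have Il : I (x - k).
  by apply: d'I; rewrite addrAC subrr add0r normrN gtr0_norm// ge_min lexx orbT.
have := dP (x + k); have := dP (x - k).
rewrite (_ : x + k - x = k); last by ring.
rewrite (_ : x - k - x = - k); last by ring.
rewrite normrN (gtr0_norm k0) ge_min lexx/= => /(_ erefl) + /(_ erefl).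
rewrite !ler_norml => /andP[a1 a2] /andP[a3 a4].
have tilt_cont (c w : R) : {for x, continuous (fun z => f z + c * (w - z))}.
  apply: cvgD => //; apply: cvgM; first exact: cvg_cst.
  by apply: cvgB; [exact: cvg_cst|exact: cvg_id].
have up : \forall z \near x, f (x + k) < f z + (derive1 f x + e) * (x + k - z).
  have /cvgr_gt := tilt_cont (derive1 f x + e) (x + k); apply; nra.
have lo : \forall z \near x, f (x - k) < f z + (derive1 f x - e) * (x - k - z).
  have /cvgr_gt := tilt_cont (derive1 f x - e) (x - k); apply; nra.
have k20 : 0 < k / 2 by lra.
near=> z; have Iz : I z by near: z; exact: near_open_set.
have h1 : f (x + k) < f z + (derive1 f x + e) * (x + k - z) by near: z.
have h2 : f (x - k) < f z + (derive1 f x - e) * (x - k - z) by near: z.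
have : `|z - x| <= k / 2 by near: z; exact: near_dist.
rewrite ler_norml => /andP[z1 z2].
have := convex_on_tangent oI cf Iz Ir (dfP z Iz).
have := convex_on_tangent oI cf Iz Il (dfP z Iz).
rewrite ler_norml => t1 t2; apply/andP; split; nra.
Unshelve. all: by end_near. Qed.

(** * The kernel along a line *)

Lemma Ck1P (R : realType) (I : set R) (f : R -> R) : open I ->
  Ck I 1 f <-> forall x, I x -> derivable f x 1 /\ {for x, continuous (derive1 f)}.
Proof.
move=> oI; rewrite /Ck (continuous_open_subspace _ oI); split.
  by move=> [df cf] x Ix; split; [exact: (df 0%N)|apply: cf; rewrite inE].
move=> h; split=> [[|//] _ x Ix|x]; first exact: (h x Ix).1.
by rewrite inE => Ix; exact: (h x Ix).2.
Qed.

Lemma Ck2P (R : realType) (I : set R) (f : R -> R) : open I ->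
  Ck I 2 f <-> forall x, I x -> [/\ derivable f x 1, derivable (derive1 f) x 1 &
    {for x, continuous (derive1 (derive1 f))}].
Proof.
move=> oI; rewrite /Ck (continuous_open_subspace _ oI); split.
  move=> [df cf] x Ix; split; [exact: (df 0%N)|exact: (df 1%N)|].
  by apply: cf; rewrite inE.
move=> h; split=> [[_ x Ix|[_ x Ix|//]]|x].
- by have [df _ _] := h x Ix; exact: df.
- by have [_ df _] := h x Ix; exact: df.
- by rewrite inE => Ix; have [_ _ cf] := h x Ix; exact: cf.
Qed.

Lemma derivable_is_derive (R : realType) (f : R -> R) (x : R) :
  derivable f x 1 -> is_derive x 1 f (derive1 f x).
Proof. by move=> /derivableP; rewrite derive1E. Qed.

Lemma is_derive_derive1 (R : realType) (f : R -> R) (x m : R) :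
  is_derive x 1 f m -> derive1 f x = m.
Proof. by rewrite derive1E; case. Qed.

Lemma derivable_continuous (R : realType) (f : R -> R) (x : R) :
  derivable f x 1 -> {for x, continuous f}.
Proof. by move=> /derivable1_diffP; exact: differentiable_continuous. Qed.

Lemma is_derive_mul (R : realType) (f g : R -> R) (x a b : R) :
  is_derive x 1 f a -> is_derive x 1 g b ->
  is_derive x 1 (fun z => f z * g z) (a * g x + f x * b).
Proof.
move=> df dg; have := is_deriveM df dg; congr is_derive.
by rewrite addrC mulrC.
Qed.

Lemma is_derive_inv (R : realType) (f : R -> R) (x a : R) :
  f x != 0 -> is_derive x 1 f a ->
  is_derive x 1 (fun z => (f z)^-1) (- a / f x ^+ 2).
Proof.
move=> fx df; have := is_deriveV fx df; congr is_derive.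
by rewrite mulNr scaleNr mulrC.
Qed.

Lemma is_derive_sub (R : realType) (f g : R -> R) (x a b : R) :
  is_derive x 1 f a -> is_derive x 1 g b ->
  is_derive x 1 (fun z => f z - g z) (a - b).
Proof. by move=> df dg; exact: is_deriveB df dg. Qed.

Lemma is_derive_along (R : realType) (f : R -> R) (x a t m : R) :
  is_derive (x + t * a) 1 f m -> is_derive t 1 (fun s => f (x + s * a)) (m * a).
Proof.
move=> df; have dg : is_derive t 1 (fun s => x + s * a) a.
  by have := is_derive_line x a 0 t; congr is_derive; apply/funext => z; ring.
exact: (is_derive1_comp (g := fun s => x + s * a)).
Qed.

(** The two partial derivatives of the kernel, written as they occur in
    conditions (iii) and (iv). *)
Definition kernel_dx (R : realType) (f p : R -> R) (x u : R) : R :=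
  (derive1 (p \* f) x - f u * derive1 p x) / ((p \* derive1 f) u).

Definition kernel_du (R : realType) (f p : R -> R) (x u : R) : R :=
  p x * (((f u - f x) * derive1 (p \* derive1 f) u
          - (p \* derive1 f) u * derive1 f u) / (p \* derive1 f) u ^+ 2).

Lemma kernel_is_derive_along (R : realType) (f p : R -> R) (x u a b t : R) :
  derivable f (x + t * a) 1 -> derivable p (x + t * a) 1 ->
  derivable f (u + t * b) 1 -> derivable p (u + t * b) 1 ->
  derivable (derive1 f) (u + t * b) 1 ->
  p (u + t * b) != 0 -> derive1 f (u + t * b) != 0 ->
  is_derive t 1 (fun s => bajraktarevic_kernel f p (x + s * a) (u + s * b))
    (kernel_dx f p (x + t * a) (u + t * b) * a
     + kernel_du f p (x + t * a) (u + t * b) * b).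
Proof.
move=> /derivable_is_derive fX /derivable_is_derive pX /derivable_is_derive fU.
move=> /derivable_is_derive pU /derivable_is_derive f'U pU0 fU0.
have dpf := is_derive_derive1 (is_derive_mul pX fX).
have dpf' := is_derive_derive1 (is_derive_mul pU f'U).
have D0 : p (u + t * b) * derive1 f (u + t * b) != 0 by rewrite mulf_neq0.
have dB := is_derive_sub (is_derive_along fX) (is_derive_along fU).
have dD := is_derive_mul (is_derive_along pU) (is_derive_along f'U).
have dV := is_derive_inv (f := fun s => p (u + s * b) * derive1 f (u + s * b)) D0 dD.
have := is_derive_mul (is_derive_mul (is_derive_along pX) dB) dV.
congr is_derive; rewrite /kernel_dx /kernel_du dpf dpf' /=.
by field; rewrite pU0 fU0.
Qed.

Lemma convex_kernelP (R : realType) (I : set R) (K : R -> R -> R) :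
  @convex_function R (R^o * R^o)%type (I `*` I) (fun z => K z.1 z.2) <->
  forall t x y u v : R, 0 <= t <= 1 -> I x -> I y -> I u -> I v ->
    K (t * x + (1 - t) * y) (t * u + (1 - t) * v) <= t * K x u + (1 - t) * K y v.
Proof.
split=> [cK t x y u v /andP[t0 t1] Ix Iy Iu Iv|cK t [x u] [y v]].
  by apply: (cK (Itv01 t0 t1) (x, u) (y, v)); rewrite inE.
rewrite !inE => -[Ix Iu] [Iy Iv].
have t01 : 0 <= t%:num <= 1 by rewrite ge0 le1.
exact: (cK _ x y u v t01 Ix Iy Iu Iv).
Qed.

Lemma convex_kernel_along (R : realType) (I : set R) (K : R -> R -> R) (x u a b : R) :
  @convex_function R (R^o * R^o)%type (I `*` I) (fun z => K z.1 z.2) ->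
  convex_on [set s | I (x + s * a) /\ I (u + s * b)]
    (fun s => K (x + s * a) (u + s * b)).
Proof.
move=> /convex_kernelP cK s r t [Isx Isu] [Itx Itu] /andP[sr rt].
have [st|st] := eqVneq s t; first by have -> : r = s; [lra|rewrite -st; lra].
have {}st : 0 < t - s by rewrite subr_gt0 lt_neqAle st (le_trans sr).
pose l := (t - r) / (t - s).
have l01 : 0 <= l <= 1.
  by rewrite /l ler_pdivrMr// ler_pdivlMr//; apply/andP; split; lra.
have := cK l _ _ _ _ l01 Isx Itx Isu Itu.
have l1 : 1 - l = (r - s) / (t - s) by rewrite /l; field; lra.
have -> : l * (x + s * a) + (1 - l) * (x + t * a) = x + r * a.
  by rewrite l1 /l; field; lra.
have -> : l * (u + s * b) + (1 - l) * (u + t * b) = u + r * b.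
  by rewrite l1 /l; field; lra.
rewrite -(ler_pM2l st) => h; apply: (le_trans h).
by rewrite l1 /l le_eqVlt; apply/orP; left; apply/eqP; field; lra.
Qed.

(** * Continuous differentiability of a factor of convex functions *)

(** Dividing the supporting lines of g * A1 and g * A2 at x by A1 > 0 and A2 < 0
    gives two differentiable functions that agree with g at x, one below g and
    the other above g. *)
Lemma factor_derivable (R : realType) (I : set R) (g A1 A2 : R -> R) (x : R) :
  open I -> I x ->
  convex_on I (fun z => g z * A1 z) -> convex_on I (fun z => g z * A2 z) ->
  derivable A1 x 1 -> derivable A2 x 1 -> A1 x * A2 x < 0 ->
  derivable g x 1.
Proof.
move=> oI Ix; wlog A1x : A1 A2 / 0 < A1 x.
  move=> wl c1 c2 d1 d2 A12.
  have [A1x|A1x] := ltP 0 (A1 x); first exact: (wl A1 A2).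
  apply: (wl A2 A1) => //; last by rewrite mulrC.
  by have : A1 x <> 0 by [move=> e; move: A12; rewrite e mul0r ltxx]; nra.
move=> c1 c2 d1 d2; rewrite (pmulr_rlt0 _ A1x) => A2x.
have [s1 h1] := convex_on_subgradient oI c1 Ix.
have [s2 h2] := convex_on_subgradient oI c2 Ix.
have A1x0 : A1 x != 0 by rewrite gt_eqF.
have A2x0 : A2 x != 0 by rewrite lt_eqF.
pose l z := (g x * A1 x + s1 * (z - x)) / A1 z.
pose h z := (g x * A2 x + s2 * (z - x)) / A2 z.
have dl := is_derive_mul (is_derive_line (g x * A1 x) s1 x x)
  (is_derive_inv A1x0 (derivable_is_derive d1)).
have dh := is_derive_mul (is_derive_line (g x * A2 x) s2 x x)
  (is_derive_inv A2x0 (derivable_is_derive d2)).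
have lx : l x = g x.
  by rewrite /l subrr mulr0 addr0 mulfK.
have hx : h x = g x.
  by rewrite /h subrr mulr0 addr0 mulfK.
have nA1 : \forall z \near x, 0 < A1 z.
  by have /cvgr_gt := derivable_continuous d1; apply.
have nA2 : \forall z \near x, A2 z < 0.
  by have /cvgr_lt := derivable_continuous d2; apply.
have lgh : \forall z \near x, l z <= g z <= h z.
  near=> z; have Iz : I z by near: z; exact: near_open_set.
  rewrite /l /h ler_pdivrMr ?h1//; last by near: z.
  by rewrite ler_ndivlMr ?h2//; near: z.
have lh : \forall z \near x, l z <= h z.
  near=> z; have /andP[lg gh] : l z <= g z <= h z by near: z.
  exact: le_trans gh.
have slopes := touching_derivative (etrans lx (esym hx)) lh dl dh.
rewrite -slopes in dh.
by have [] := squeeze_derivative lx hx lgh dl dh.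
Unshelve. all: by end_near. Qed.

Lemma factor_derive1_continuous (R : realType) (I : set R) (g A : R -> R) (x : R) :
  open I -> I x -> convex_on I (fun z => g z * A z) ->
  (forall z, I z -> derivable g z 1) -> (forall z, I z -> derivable A z 1) ->
  {for x, continuous (derive1 A)} -> A x != 0 ->
  {for x, continuous (derive1 g)}.
Proof.
move=> oI Ix cgA dg dA cA' Ax.
have dgA z : I z -> is_derive z 1 (fun z => g z * A z)
    (derive1 g z * A z + g z * derive1 A z).
  by move=> Iz; apply: is_derive_mul; apply: derivable_is_derive; [exact: dg|exact: dA].
have cgA' : {for x, continuous (derive1 (fun z => g z * A z))}.
  apply: (convex_derive1_continuous oI cgA _ Ix) => z Iz.
  by have [] := dgA z Iz.
have cg := derivable_continuous (dg x Ix).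
have cA := derivable_continuous (dA x Ix).
have nA : \forall z \near x, A z != 0 by have /cvgr_neq0 := cA; apply.
have E z : I z -> A z != 0 ->
    (derive1 (fun z => g z * A z) z - g z * derive1 A z) / A z = derive1 g z.
  by move=> Iz Az; rewrite (is_derive_derive1 (dgA z Iz)) addrK mulfK.
have : derive1 g z @[z --> x] -->
    (derive1 (fun z => g z * A z) x - g x * derive1 A x) / A x.
  apply: cvg_trans (cvgM (cvgB cgA' (cvgM cg cA')) (cvgV Ax cA)).
  apply: near_eq_cvg; near=> z.
  have Iz : I z by near: z; exact: near_open_set.
  have Az : A z != 0 by near: z.
  by have /= := E z Iz Az.
by rewrite (E x Ix Ax).
Unshelve. all: by end_near. Qed.

(** * From the kernel to the mean *)

Definition strictly_monotone (R : realType) (I : set R) (f : R -> R) :=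
  {in I &, {homo f : x y / x < y}} \/ {in I &, {homo f : x y /~ x < y}}.

Lemma strictly_monotone_inj (R : realType) (I : set R) (f : R -> R) :
  strictly_monotone I f -> {in I &, injective f}.
Proof.
move=> mf x y Ix Iy fxy; case: (ltgtP x y) => // xy; case: mf => mf.
- by have := mf _ _ Ix Iy xy; rewrite fxy ltxx.
- by have := mf _ _ Iy Ix xy; rewrite fxy ltxx.
- by have := mf _ _ Iy Ix xy; rewrite fxy ltxx.
- by have := mf _ _ Ix Iy xy; rewrite fxy ltxx.
Qed.

(** Dividing by a value of the derivative absorbs the sign of the increments, so
    that increasing and decreasing functions can be treated together. *)
Lemma increment_over_derive1_gt0 (R : realType) (I : set R) (f : R -> R) (u x w : R) :
  open I -> strictly_monotone I f -> (forall z, I z -> derivable f z 1) ->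
  I u -> I x -> I w -> derive1 f w != 0 -> u < x -> 0 < (f x - f u) / derive1 f w.
Proof.
move=> oI mf df Iu Ix Iw f'0 ux.
have inI z : I z -> z \in I by rewrite inE.
have Iint : I° = I by rewrite -interior_id.
have Iw0 : I° w by rewrite Iint.
have dI : {in I° : set R, forall z, derivable f z 1}.
  by move=> z; rewrite inE Iint; exact: df.
case: mf => mf.
- have := mf u x (inI _ Iu) (inI _ Ix) ux; rewrite -subr_gt0 => fux.
  by rewrite divr_gt0// lt_neqAle eq_sym f'0 (incr_derive1_ge0 dI).
- have := mf x u (inI _ Ix) (inI _ Iu) ux; rewrite -subr_lt0 => fux.
  by rewrite nmulr_rgt0// invr_lt0 lt_neqAle f'0 (decr_derive1_le0 dI).
Qed.

Lemma weighted_mean_interval (R : realType) (J : set R) (n : nat) (w y : 'I_n -> R) :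
  is_interval J -> (0 < n)%N -> (forall i, 0 < w i) -> (forall i, J (y i)) ->
  J ((\sum_(i < n) w i * y i) / \sum_(i < n) w i).
Proof.
case: n w y => // n w y iJ _ w0 Jy.
pose lo := [arg min_(i < ord0) y i]%O; pose hi := [arg max_(i > ord0) y i]%O.
have ylo i : y lo <= y i by rewrite /lo; case: Order.TotalTheory.arg_minP => // j _; exact.
have yhi i : y i <= y hi by rewrite /hi; case: Order.TotalTheory.arg_maxP => // j _; exact.
have W0 : 0 < \sum_(i < n.+1) w i.
  by rewrite big_ord_recl ltr_pwDl// sumr_ge0// => i _; exact: ltW.
apply: (iJ (y lo) (y hi)) => //.
rewrite ler_pdivlMr// ler_pdivrMr// !mulr_sumr.
by apply/andP; split; apply: ler_sum => i _; rewrite ?(mulrC (y lo)) ?(mulrC (y hi)) ler_pM2l.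
Qed.

(** The equation that characterises the mean; unlike the formula with the
    inverse of f, it is additive over the entries. *)
Lemma bajraktarevic_meanP (R : realType) (I : set R) (f p : R -> R) (n : nat)
    (x : 'rV[R]_n) :
  is_interval I -> strictly_monotone I f -> {within I, continuous f} ->
  (forall z, I z -> 0 < p z) -> (0 < n)%N -> (forall i, I (x ord0 i)) ->
  let m := bajraktarevic_mean I f p x in
  I m /\ \sum_(i < n) p (x ord0 i) * (f (x ord0 i) - f m) = 0.
Proof.
move=> iI mf cf p0 n0 Ix m.
have ifI : is_interval (f @` I).
  by apply/connected_intervalP/connected_continuous_connected => //; apply/connected_intervalP.
pose s := (\sum_(i < n) p (x ord0 i) * f (x ord0 i)) / \sum_(i < n) p (x ord0 i).
have sf : (f @` I) s.
  apply: weighted_mean_interval => // i; first by exact: p0.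
  by exists (x ord0 i).
have fm : f m = s by apply: pinvK; rewrite inE.
split.
  have := injpinv_image (fun=> point) (strictly_monotone_inj mf).
  by move=> /seteqP[+ _]; apply; exists s.
have W0 : \sum_(i < n) p (x ord0 i) != 0.
  case: n n0 x Ix m s sf fm => // n _ x Ix _ _ _ _.
  rewrite gt_eqF// big_ord_recl ltr_pwDl//; first exact: p0.
  by rewrite sumr_ge0// => i _; apply/ltW/p0.
under eq_bigr do rewrite mulrBr.
by rewrite sumrB -mulr_suml fm /s mulrC divfK// subrr.
Qed.

(** The kernel sums to zero against the mean of its first arguments, and the sign
    of its sum against another point w tells on which side of w the mean lies. *)
Lemma jensen_kernel_mean (R : realType) (I : set R) (f p : R -> R) :
  open I -> is_interval I -> strictly_monotone I f -> {within I, continuous f} ->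
  (forall x, I x -> 0 < p x) -> (forall x, I x -> derivable f x 1) ->
  (forall x, I x -> derive1 f x != 0) ->
  (forall x y u v, I x -> I y -> I u -> I v ->
    bajraktarevic_kernel f p ((x + y) / 2) ((u + v) / 2)
      <= (bajraktarevic_kernel f p x u + bajraktarevic_kernel f p y v) / 2) ->
  jensen_convex_mean I (bajraktarevic_mean I f p).
Proof.
move=> oI iI mf cf p0 df f'0 JB n x y n0 Ix Iy.
have mid_I a b : I a -> I b -> I ((a + b) / 2).
  move=> Ia Ib; have [ab|ba] := leP a b.
    by apply: (iI a b) => //; apply/andP; split; lra.
  by apply: (iI b a) => //; apply/andP; split; lra.
have midE i : (2^-1 *: (x + y)) ord0 i = (x ord0 i + y ord0 i) / 2.
  by rewrite !mxE mulrC.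
have Iz i : I ((2^-1 *: (x + y)) ord0 i) by rewrite midE; exact: mid_I.
have [] := bajraktarevic_meanP iI mf cf p0 n0 Ix.
have [] := bajraktarevic_meanP iI mf cf p0 n0 Iy.
have [] := bajraktarevic_meanP iI mf cf p0 n0 Iz.
set m := bajraktarevic_mean _ _ _ _; set v := bajraktarevic_mean _ _ _ _.
set u := bajraktarevic_mean _ _ _ _.
move=> Im mE Iv vE Iu uE; rewrite leNgt; apply/negP => wm.
pose w := (u + v) / 2; have Iw : I w by exact: mid_I.
pose B := bajraktarevic_kernel f p.
have sumB (z : 'rV[R]_n) c : \sum_(i < n) B (z ord0 i) c =
    (\sum_(i < n) p (z ord0 i) * (f (z ord0 i) - f c)) / (p c * derive1 f c).
  by rewrite mulr_suml.
have le0 : \sum_(i < n) B ((2^-1 *: (x + y)) ord0 i) w <= 0.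
  rewrite (@le_trans _ _ (\sum_(i < n) (B (x ord0 i) u + B (y ord0 i) v) / 2))//.
    by apply: ler_sum => i _; rewrite midE; exact: JB.
  by rewrite -mulr_suml big_split/= !sumB uE vE !mul0r addr0 mul0r.
have := increment_over_derive1_gt0 oI mf df Iw Im Iw (f'0 _ Iw) wm => fwm.
move: le0; rewrite leNgt => /negP; apply.
have -> : \sum_(i < n) B ((2^-1 *: (x + y)) ord0 i) w =
    (\sum_(i < n) p ((2^-1 *: (x + y)) ord0 i)) / p w * ((f m - f w) / derive1 f w).
  rewrite sumB; set z := 2^-1 *: (x + y) in mE *.
  have -> : \sum_(i < n) p (z ord0 i) * (f (z ord0 i) - f w) =
      \sum_(i < n) p (z ord0 i) * (f (z ord0 i) - f m)
      + (\sum_(i < n) p (z ord0 i)) * (f m - f w).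
    by rewrite mulr_suml -big_split/=; apply: eq_bigr => i _; ring.
  by rewrite mE add0r invfM; ring.
rewrite mulr_gt0// divr_gt0 ?p0//.
case: n n0 x y Ix Iy midE Iz @m Im mE @v @u Iv vE Iu uE wm @w Iw sumB fwm => // n _ x y.
move=> _ _ _ Iz *; rewrite big_ord_recl ltr_pwDl//; first exact: p0.
by rewrite sumr_ge0// => i _; apply/ltW/p0.
Qed.

Lemma interval_segment (R : realType) (I : set R) (x y t : R) :
  is_interval I -> I x -> I y -> 0 <= t <= 1 -> I (x + t * (y - x)).
Proof.
move=> iI Ix Iy /andP[t0 t1]; have [xy|yx] := leP x y.
  by apply: (iI x y) => //; apply/andP; split; nra.
by apply: (iI y x) => //; apply/andP; split; nra.
Qed.

(** By the mean value theorem, the increments of the kernel over the two halves of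
    the segment from (x, u) to (y, v) are directional derivatives at an earlier
    and at a later point. *)
Lemma gradient_monotone_jensen (R : realType) (I : set R) (f p : R -> R) :
  is_interval I -> (forall x, I x -> 0 < p x) ->
  (forall x, I x -> derivable f x 1) -> (forall x, I x -> derivable p x 1) ->
  (forall x, I x -> derivable (derive1 f) x 1) -> (forall x, I x -> derive1 f x != 0) ->
  (forall x y u v, I x -> I y -> I u -> I v ->
    0 <= (kernel_dx f p x u - kernel_dx f p y v) * (x - y)
       + (kernel_du f p x u - kernel_du f p y v) * (u - v)) ->
  forall x y u v, I x -> I y -> I u -> I v ->
    bajraktarevic_kernel f p ((x + y) / 2) ((u + v) / 2)
      <= (bajraktarevic_kernel f p x u + bajraktarevic_kernel f p y v) / 2.
Proof.
move=> iI p0 df dp d2f f'0 mono x y u v Ix Iy Iu Iv.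
pose X s := x + s * (y - x); pose U s := u + s * (v - u).
pose g s := bajraktarevic_kernel f p (X s) (U s).
pose g' s := kernel_dx f p (X s) (U s) * (y - x) + kernel_du f p (X s) (U s) * (v - u).
have IX (s : R) : 0 <= s <= 1 -> I (X s) by exact: interval_segment.
have IU (s : R) : 0 <= s <= 1 -> I (U s) by exact: interval_segment.
have dg (s : R) : 0 <= s <= 1 -> is_derive s 1 g (g' s).
  move=> s01; have Xs := IX s s01; have Us := IU s s01.
  apply: kernel_is_derive_along;
    [exact: df|exact: dp|exact: df|exact: dp|exact: d2f| |exact: f'0].
  by rewrite gt_eqF// p0.
have mvt (a b : R) : 0 <= a -> a < b -> b <= 1 ->
    exists2 c, a < c < b & g b - g a = g' c * (b - a).
  move=> a0 ab b1.
  have [||c cab ->] := @MVT _ g g' a b ab; last by exists c.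
    move=> s; rewrite in_itv/= => /andP[as_ sb]; apply: dg; apply/andP; split; lra.
  apply: derivable_within_continuous => s; rewrite in_itv/= => /andP[as_ sb].
  by have [] := dg s ltac:(apply/andP; split; lra).
have [c1 /andP[c10 c11] e1] := mvt 0 (1 / 2) ltac:(lra) ltac:(lra) ltac:(lra).
have [c2 /andP[c20 c21] e2] := mvt (1 / 2) 1 ltac:(lra) ltac:(lra) ltac:(lra).
have c1I : 0 <= c1 <= 1 by rewrite ltW//= ltW// (lt_trans c11)//; lra.
have c2I : 0 <= c2 <= 1 by rewrite (ltW c21) andbT ltW// (lt_trans _ c20)//; lra.
have := mono _ _ _ _ (IX _ c1I) (IX _ c2I) (IU _ c1I) (IU _ c2I).
have -> : X c1 - X c2 = (c1 - c2) * (y - x) by rewrite /X; ring.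
have -> : U c1 - U c2 = (c1 - c2) * (v - u) by rewrite /U; ring.
have -> (a b c d : R) : (a - b) * ((c1 - c2) * (y - x)) + (c - d) * ((c1 - c2) * (v - u))
  = (c2 - c1) * ((b * (y - x) + d * (v - u)) - (a * (y - x) + c * (v - u))) by ring.
rewrite -/(g' c1) -/(g' c2) pmulr_rge0; last by lra.
rewrite subr_ge0 => g'12.
have E0 : g 0 = bajraktarevic_kernel f p x u by rewrite /g /X /U !mul0r !addr0.
have E1 : g 1 = bajraktarevic_kernel f p y v.
  by rewrite /g /X /U !mul1r !(addrC _ (_ - _)) !subrK.
have Eh : g (1 / 2) = bajraktarevic_kernel f p ((x + y) / 2) ((u + v) / 2).
  by rewrite /g /X /U; congr bajraktarevic_kernel; field.
by rewrite -E0 -E1 -Eh; lra.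
Qed.

(** * Regularity from convexity of the kernel *)

(** The sections of the kernel are p (resp. q = 1 / (p f')) times a C^1 function
    that changes sign, which makes p and q of class C^1, hence f' = 1 / (p q). *)
Lemma convex_kernel_smooth (R : realType) (I : set R) (f p : R -> R) :
  open I -> is_interval I -> strictly_monotone I f -> (forall x, I x -> 0 < p x) ->
  Ck_sharp I 1 f ->
  @convex_function R (R^o * R^o)%type (I `*` I)
    (fun z => bajraktarevic_kernel f p z.1 z.2) ->
  Ck_sharp I 2 f /\ Ck I 1 p.
Proof.
move=> oI iI mf p0 [Cf f'0] cB.
have df x : I x -> derivable f x 1 by move=> Ix; have [] := (Ck1P f oI).1 Cf x Ix.
have cf' x : I x -> {for x, continuous (derive1 f)}.
  by move=> Ix; have [] := (Ck1P f oI).1 Cf x Ix.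
have cf x : I x -> {for x, continuous f} by move=> /df; exact: derivable_continuous.
have two_sides x : I x -> exists2 a, I a & exists2 b, I b &
    forall w, I w -> 0 < (f x - f a) / derive1 f w /\ (f x - f b) / derive1 f w < 0.
  move=> Ix; have [e e0 eI] := open_nbhs_itv oI Ix.
  have Ir : I (x + e) by apply: eI; rewrite addrAC subrr add0r gtr0_norm.
  have Il : I (x - e) by apply: eI; rewrite addrAC subrr add0r normrN gtr0_norm.
  exists (x - e) => //; exists (x + e) => // w Iw; split.
    apply: (increment_over_derive1_gt0 oI mf df Il Ix Iw (f'0 _ Iw)); lra.
  rewrite -oppr_gt0 -mulNr opprB.
  apply: (increment_over_derive1_gt0 oI mf df Ix Ir Iw (f'0 _ Iw)); lra.
pose q z := (p z * derive1 f z)^-1.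
have sec_x u : I u -> convex_on I (fun z => p z * ((f z - f u) * q u)).
  move=> Iu; have := convex_kernel_along (x := 0) (u := u) (a := 1) (b := 0) cB.
  move=> cx a z b Ia Ib azb; have := cx a z b; rewrite /= !add0r !mulr1 !mulr0 !addr0.
  by rewrite /bajraktarevic_kernel !mulrA; apply.
have sec_u x : I x -> convex_on I (fun z => q z * (p x * (f x - f z))).
  move=> Ix; have := convex_kernel_along (x := x) (u := 0) (a := 0) (b := 1) cB.
  move=> cx a z b Ia Ib azb; have := cx a z b; rewrite /= !add0r !mulr1 !mulr0 !addr0.
  by rewrite /bajraktarevic_kernel ![_ / _]mulrC; apply.
have dsec_x u z : I z -> is_derive z 1 (fun z => (f z - f u) * q u) (derive1 f z * q u).
  move=> Iz; have := is_derive_mul (is_derive_sub (derivable_is_derive (df z Iz))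
    (is_derive_cst (f u) z 1)) (is_derive_cst (q u) z 1).
  by congr is_derive; rewrite subr0 mulr0 addr0.
have dsec_u x z : I z -> is_derive z 1 (fun z => p x * (f x - f z)) (- p x * derive1 f z).
  move=> Iz; have := is_derive_mul (is_derive_cst (p x) z 1)
    (is_derive_sub (is_derive_cst (f x) z 1) (derivable_is_derive (df z Iz))).
  by congr is_derive; rewrite mul0r add0r sub0r mulrN mulNr.
have q0 z : I z -> q z != 0 by move=> Iz; rewrite invr_eq0 mulf_neq0 ?f'0// gt_eqF// p0.
have dp x : I x -> derivable p x 1.
  move=> Ix; have [a Ia [b Ib ab]] := two_sides x Ix.
  apply: (factor_derivable oI Ix (sec_x a Ia) (sec_x b Ib)).
  - by have [] := dsec_x a x Ix.
  - by have [] := dsec_x b x Ix.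
  - have qE w : (f x - f w) * q w = (p w)^-1 * ((f x - f w) / derive1 f w).
      by rewrite /q invfM; ring.
    rewrite !qE pmulr_rlt0; last by rewrite mulr_gt0 ?invr_gt0 ?p0//; exact: (ab a Ia).1.
    by rewrite pmulr_rlt0 ?invr_gt0 ?p0//; exact: (ab b Ib).2.
have dq x : I x -> derivable q x 1.
  move=> Ix; have [a Ia [b Ib ab]] := two_sides x Ix.
  apply: (factor_derivable oI Ix (sec_u a Ia) (sec_u b Ib)).
  - by have [] := dsec_u a x Ix.
  - by have [] := dsec_u b x Ix.
  - have [a0 b0] := ab x Ix.
    have : (f x - f a) / derive1 f x * ((f x - f b) / derive1 f x) < 0.
      by rewrite pmulr_rlt0.
    rewrite mulrACA -invfM pmulr_llt0; last first.
      by rewrite invr_gt0 -expr2 exprn_even_gt0//= f'0.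
    by have := mulr_gt0 (p0 a Ia) (p0 b Ib); nra.
have cp' x : I x -> {for x, continuous (derive1 p)}.
  move=> Ix; have [a Ia [b Ib ab]] := two_sides x Ix.
  have A'E z : I z -> derive1 (fun z => (f z - f a) * q a) z = derive1 f z * q a.
    by move=> Iz; exact: is_derive_derive1 (dsec_x a z Iz).
  apply: (factor_derive1_continuous oI Ix (sec_x a Ia) dp) => [z Iz||].
  - by have [] := dsec_x a z Iz.
  - have : derive1 f z * q a @[z --> x] --> derive1 (fun z => (f z - f a) * q a) x.
      by rewrite A'E//; apply: cvgM; [exact: cf'|exact: cvg_cst].
    apply: cvg_trans; apply: near_eq_cvg; near=> z; rewrite A'E//.
    by near: z; exact: near_open_set.
  - rewrite mulf_neq0 ?q0//; apply/eqP => e; have := (ab x Ix).1.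
    by rewrite e mul0r ltxx.
have cq' x : I x -> {for x, continuous (derive1 q)}.
  move=> Ix; have [a Ia [b Ib ab]] := two_sides x Ix.
  have A'E z : I z -> derive1 (fun z => p a * (f a - f z)) z = - p a * derive1 f z.
    by move=> Iz; exact: is_derive_derive1 (dsec_u a z Iz).
  apply: (factor_derive1_continuous oI Ix (sec_u a Ia) dq) => [z Iz||].
  - by have [] := dsec_u a z Iz.
  - have : - p a * derive1 f z @[z --> x] --> derive1 (fun z => p a * (f a - f z)) x.
      by rewrite A'E//; apply: cvgM; [exact: cvg_cst|exact: cf'].
    apply: cvg_trans; apply: near_eq_cvg; near=> z; rewrite A'E//.
    by near: z; exact: near_open_set.
  - rewrite mulf_neq0//; first by rewrite gt_eqF// p0.
    rewrite -opprB oppr_eq0; apply/eqP => e.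
    by have := (ab x Ix).1; rewrite e mul0r ltxx.
have f'E z : I z -> derive1 f z = (p z * q z)^-1.
  move=> Iz; rewrite /q; field.
  by rewrite f'0// gt_eqF// p0.
have df'P x : I x -> is_derive x 1 (derive1 f)
    (- (derive1 p x * q x + p x * derive1 q x) / (p x * q x) ^+ 2).
  move=> Ix; have pq0 : p x * q x != 0 by rewrite mulf_neq0 ?q0// gt_eqF// p0.
  have dpq := is_derive_mul (derivable_is_derive (dp x Ix)) (derivable_is_derive (dq x Ix)).
  apply: near_eq_is_derive (is_derive_inv (f := fun z => p z * q z) pq0 dpq).
  by near=> z; rewrite f'E//; near: z; exact: near_open_set.
split; last by apply/Ck1P => // x Ix; split; [exact: dp|exact: cp'].
split; last exact: f'0.
apply/Ck2P => // x Ix; split; [exact: df|by have [] := df'P x Ix|].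
have pq0 : p x * q x != 0 by rewrite mulf_neq0 ?q0// gt_eqF// p0.
have cp := derivable_continuous (dp x Ix); have cq := derivable_continuous (dq x Ix).
have : - (derive1 p z * q z + p z * derive1 q z) / (p z * q z) ^+ 2 @[z --> x]
    --> derive1 (derive1 f) x.
  rewrite (is_derive_derive1 (df'P x Ix)).
  apply: cvgM.
    by apply: cvgN; apply: cvgD; apply: cvgM => //; [exact: cp'|exact: cq'].
  by apply: cvgV; [rewrite expf_neq0|apply: cvgM; apply: cvgM].
apply: cvg_trans; apply: near_eq_cvg; near=> z.
rewrite (is_derive_derive1 (df'P z _))//.
by near: z; exact: near_open_set.
Unshelve. all: by end_near. Qed.

Lemma convex_kernel_gradient (R : realType) (I : set R) (f p : R -> R) :
  open I -> (forall x, I x -> 0 < p x) ->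
  (forall x, I x -> derivable f x 1) -> (forall x, I x -> derivable p x 1) ->
  (forall x, I x -> derivable (derive1 f) x 1) -> (forall x, I x -> derive1 f x != 0) ->
  @convex_function R (R^o * R^o)%type (I `*` I)
    (fun z => bajraktarevic_kernel f p z.1 z.2) ->
  forall x y u v, I x -> I y -> I u -> I v ->
    bajraktarevic_kernel f p x u + kernel_dx f p x u * (y - x)
      + kernel_du f p x u * (v - u) <= bajraktarevic_kernel f p y v.
Proof.
move=> oI p0 df dp d2f f'0 cB x y u v Ix Iy Iu Iv.
have along0 (c d : R) : c + 0 * d = c by rewrite mul0r addr0.
have along1 (c d : R) : c + 1 * (d - c) = d by rewrite mul1r addrC subrK.
pose J := [set s | I (x + s * (y - x)) /\ I (u + s * (v - u))].
have preim_open (c d : R) : open [set s | I (c + s * d)].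
  rewrite -/((fun s => c + s * d) @^-1` I); apply: open_comp => // s _.
  by apply: cvgD; [exact: cvg_cst|apply: cvgM; [exact: cvg_id|exact: cvg_cst]].
have oJ : open J by apply: openI; exact: preim_open.
have J0 : J 0 by split; rewrite along0.
have J1 : J 1 by split; rewrite along1.
have dB := @kernel_is_derive_along R f p x u (y - x) (v - u) 0.
rewrite !along0 in dB.
have {}dB := dB (df _ Ix) (dp _ Ix) (df _ Iu) (dp _ Iu) (d2f _ Iu)
  (lt0r_neq0 (p0 _ Iu)) (f'0 _ Iu).
have := convex_on_tangent oJ (convex_kernel_along cB) J0 J1 dB.
by rewrite !along0 !along1 subr0 mulr1 addrA.
Qed.

(** * Derivatives from short steps *)

(** The supremum of the points s with f s - f a <= m (s - a) has this property by
    continuity, and a further short step would exceed it unless it is b.  A single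
    short step at each point is enough: no limit of difference quotients is
    assumed to exist. *)
Lemma small_steps_le (R : realType) (f : R -> R) (a b m : R) :
  a <= b -> (forall s, a <= s <= b -> {for s, continuous f}) ->
  (forall s e, a <= s < b -> 0 < e ->
    exists d, [/\ 0 < d, d < e & f (s + d) - f s <= m * d]) ->
  f b - f a <= m * (b - a).
Proof.
move=> ab cf step.
pose h s := f s - f a - m * (s - a).
have ch s : a <= s <= b -> {for s, continuous h}.
  move=> /cf cfs; apply: cvgB; first by apply: cvgB => //; exact: cvg_cst.
  by apply: cvgM; [exact: cvg_cst|apply: cvgB; [exact: cvg_id|exact: cvg_cst]].
pose A := [set s | a <= s <= b /\ h s <= 0].
have Aa : A a by split; [rewrite lexx|rewrite /h !subrr mulr0 subr0].
have hA : has_sup A by split; [exists a|exists b => s [/andP[]]].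
have supA s : A s -> s <= sup A by move=> As; apply: sup_upper_bound.
have supab : a <= sup A <= b.
  by rewrite supA//=; apply: ge_sup; [exists a|move=> s [/andP[]]].
have hsup : h (sup A) <= 0.
  rewrite leNgt; apply/negP => h0.
  have /cvgr_gt/(_ _ h0)/nearP_dist[e e0 eP] := ch _ supab.
  have [s As se] := sup_adherent e0 hA.
  have := eP s; rewrite ler_norml => /(_ _); have := supA s As => ss.
  have -> : - e <= s - sup A <= e by apply/andP; split; lra.
  by move=> /(_ isT); case: As => _; rewrite leNgt => /negP.
have [bs|sb] := leP b (sup A).
  have eb : sup A = b by apply/eqP; rewrite eq_le bs andbT; case/andP: supab.
  by move: hsup; rewrite eb /h; lra.
have [as_ _] := andP supab.
have [||d [d0 db fd]] := step (sup A) (b - sup A); [by rewrite as_|by lra|].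
have : A (sup A + d).
  split; first by apply/andP; split; lra.
  by move: hsup; rewrite /h; lra.
by move=> /supA; lra.
Qed.

Lemma small_steps_ge (R : realType) (f : R -> R) (a b m : R) :
  a <= b -> (forall s, a <= s <= b -> {for s, continuous f}) ->
  (forall s e, a <= s < b -> 0 < e ->
    exists d, [/\ 0 < d, d < e & m * d <= f (s + d) - f s]) ->
  m * (b - a) <= f b - f a.
Proof.
move=> ab cf step.
have := @small_steps_le R (fun s => - f s) a b (- m) ab.
have cN s : a <= s <= b -> {for s, continuous (fun s => - f s)}.
  by move=> /cf; exact: cvgN.
move=> /(_ cN) H; suff : - f b - - f a <= - m * (b - a) by lra.
apply: H => s e se e0; have [d [d0 de fd]] := step s e se e0.
by exists d; split => //; lra.
Qed.

(** A continuous function with a continuous Dini derivative is differentiable: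
    near u the slopes c s stay between c u - e and c u + e, so all difference
    quotients near u do. *)
Lemma small_steps_derivative (R : realType) (J : set R) (f c : R -> R) :
  open J -> (forall s, J s -> {for s, continuous f}) ->
  (forall s, J s -> {for s, continuous c}) ->
  (forall s m e, J s -> c s < m -> 0 < e ->
    exists d, [/\ 0 < d, d < e & f (s + d) - f s <= m * d]) ->
  (forall s m e, J s -> m < c s -> 0 < e ->
    exists d, [/\ 0 < d, d < e & m * d <= f (s + d) - f s]) ->
  forall u, J u -> is_derive u 1 f (c u).
Proof.
move=> oJ cf cc up lo u Ju; apply/is_derive_linear_approx => e e0.
have e20 : 0 < e / 2 by lra.
have [d1 d10 d1J] := open_nbhs_itv oJ Ju.
have /cvgrPdist_le/(_ _ e20)/nearP_dist[d2 d20 d2c] := cc u Ju.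
apply/nearP_dist; exists (Num.min d1 d2); first by rewrite lt_min d10.
have incr a b : `|a - u| <= Num.min d1 d2 -> `|b - u| <= Num.min d1 d2 -> a <= b ->
    (c u - e) * (b - a) <= f b - f a <= (c u + e) * (b - a).
  rewrite !le_min => /andP[a1 a2] /andP[b1 b2] ab.
  have near_u s : a <= s <= b -> J s /\ `|c u - c s| <= e / 2.
    move=> /andP[as_ sb].
    have su d : `|a - u| <= d -> `|b - u| <= d -> `|s - u| <= d.
      rewrite !ler_norml => /andP[? ?] /andP[? ?]; apply/andP; split; lra.
    by split; [apply: d1J; exact: su|apply: d2c; exact: su].
  have half s : a <= s < b -> a <= s <= b by move=> /andP[-> /ltW].
  apply/andP; split.
    apply: small_steps_ge => // [s /near_u[/cf]//|s e' /half/near_u[Js cs] e'0].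
    by apply: lo => //; move: cs; rewrite ler_norml => /andP[? ?]; lra.
  apply: small_steps_le => // [s /near_u[/cf]//|s e' /half/near_u[Js cs] e'0].
  by apply: up => //; move: cs; rewrite ler_norml => /andP[? ?]; lra.
move=> z zu; have uu : `|u - u| <= Num.min d1 d2.
  by rewrite subrr normr0 le_min !ltW.
have [uz|zu'] := leP u z.
  have /andP[i1 i2] := incr u z uu zu uz.
  by rewrite (@ger0_norm _ (z - u)) ?subr_ge0// ler_norml; apply/andP; split; nra.
have /andP[i1 i2] := incr z u zu uu (ltW zu').
by rewrite (@ltr0_norm _ (z - u)) ?subr_lt0// ler_norml; apply/andP; split; nra.
Qed.

(** The limit superior, given by its two characteristic properties. *)
Lemma limit_superior (R : realType) (a : nat -> R) (C : R) :
  (forall k, 0 <= a k <= C) ->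
  exists L, (forall e, 0 < e -> exists N, forall k, (N <= k)%N -> a k <= L + e) /\
    (forall e N, 0 < e -> exists2 k, (N <= k)%N & L - e <= a k).
Proof.
move=> aC; pose A := [set y | exists N, forall k, (N <= k)%N -> a k <= y].
have AC : A C by exists 0%N => k _; case/andP: (aC k).
have hA : has_inf A.
  split; first by exists C.
  by exists 0 => y [N /(_ N (leqnn N))]; apply: le_trans; case/andP: (aC N).
exists (inf A); split => [e e0|e N e0].
  have [y [N Ny] ye] := inf_adherent e0 hA.
  by exists N => k /Ny ak; apply: (le_trans ak); exact: ltW.
apply: contrapT => nk; suff : inf A <= inf A - e by lra.
apply: ge_inf; [by case: hA|]; exists N => k Nk; rewrite leNgt; apply/negP => h.
by apply: nk; exists k => //; exact: ltW.
Qed.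

(** * Means of one point against many copies of another *)

(** M k x u stands for the mean of one copy of x and k copies of u.  The equation
    is linear in f, so that f can be replaced by its opposite. *)
Record one_against_many_mean (R : realType) (I : set R) (f p : R -> R)
    (M : nat -> R -> R -> R) : Prop := OneAgainstMany {
  oam_in : forall k x u, I x -> I u -> I (M k x u);
  oam_eq : forall k x u, I x -> I u ->
    (p x + k%:R * p u) * (f (M k x u) - f u) = p x * (f x - f u);
  oam_jensen : forall k x y u v, I x -> I y -> I u -> I v ->
    M k ((x + y) / 2) ((u + v) / 2) <= (M k x u + M k y v) / 2 }.

Definition increasing_on (R : realType) (I : set R) (f : R -> R) :=
  forall x y, I x -> I y -> x < y -> f x < f y.

Lemma increasing_on_ltE (R : realType) (I : set R) (f : R -> R) (x y : R) :
  increasing_on I f -> I x -> I y -> (f x < f y) = (x < y).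
Proof.
move=> incf Ix Iy; have [xy|yx|->] := ltgtP x y; last by rewrite ltxx.
  by rewrite incf.
by apply/negbTE; rewrite -leNgt ltW// incf.
Qed.

Lemma increasing_on_leE (R : realType) (I : set R) (f : R -> R) (x y : R) :
  increasing_on I f -> I x -> I y -> (f x <= f y) = (x <= y).
Proof. by move=> incf Ix Iy; rewrite !leNgt (increasing_on_ltE incf). Qed.

Section OneAgainstMany.
Context (R : realType) (I : set R) (f p : R -> R) (M : nat -> R -> R -> R).
Context (oI : open I) (iI : is_interval I) (incf : increasing_on I f)
  (cf : forall x, I x -> {for x, continuous f}) (p0 : forall x, I x -> 0 < p x)
  (hM : one_against_many_mean I f p M).

Let weight_gt0 k x u : I x -> I u -> 0 < p x + k%:R * p u.
Proof. by move=> Ix Iu; rewrite ltr_pwDl ?p0// mulr_ge0// ltW// p0. Qed.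

Lemma oam_gt k x u : I x -> I u -> u < x -> u < M k x u.
Proof.
move=> Ix Iu ux; have IM := oam_in hM k Ix Iu.
rewrite -(increasing_on_ltE incf Iu IM) -subr_gt0.
rewrite -(pmulr_rgt0 _ (weight_gt0 k Ix Iu)) (oam_eq hM)//.
by rewrite mulr_gt0 ?p0// subr_gt0 incf.
Qed.

Lemma oam_id k u : I u -> M k u u = u.
Proof.
move=> Iu; have IM := oam_in hM k Iu Iu.
have /eqP := oam_eq hM k Iu Iu; rewrite subrr mulr0 mulf_eq0.
rewrite gt_eqF ?weight_gt0//= subr_eq0 => /eqP e.
have := increasing_on_ltE incf IM Iu; have := increasing_on_ltE incf Iu IM.
by rewrite e ltxx; case: ltgtP.
Qed.

Lemma oam_le k x u : I x -> I u -> M k x u <= Num.max x u.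
Proof.
move=> Ix Iu; have IM := oam_in hM k Ix Iu.
have kpu : 0 <= k%:R * p u by rewrite mulr_ge0// ltW// p0.
have px := p0 Ix; have e := oam_eq hM k Ix Iu.
rewrite le_max -(increasing_on_leE incf IM Ix) -(increasing_on_leE incf IM Iu).
have [//|xM] /= := leP (f (M k x u)) (f x).
rewrite leNgt; apply/negP => uM.
suff : 0 < p x * (f (M k x u) - f x) + k%:R * p u * (f (M k x u) - f u) by lra.
by rewrite ltr_pwDl//; [rewrite mulr_gt0// subr_gt0|rewrite mulr_ge0// subr_ge0 ltW].
Qed.

(** On a segment, M k is midpoint convex and bounded by the maximum of its
    arguments. *)
Lemma oam_convex k :
  @convex_function R (R^o * R^o)%type (I `*` I) (fun z => M k z.1 z.2).
Proof.
apply/convex_kernelP => t x y u v t01 Ix Iy Iu Iv.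
pose X s := y + s * (x - y); pose U s := v + s * (u - v).
have IX (s : R) : `[0, 1]%classic s -> I (X s).
  by rewrite /= in_itv/= => /(interval_segment iI Iy Ix).
have IU (s : R) : `[0, 1]%classic s -> I (U s).
  by rewrite /= in_itv/= => /(interval_segment iI Iv Iu).
have i01 : is_interval (`[0, 1]%classic : set R) by exact: interval_is_interval.
have cG : convex_on `[0, 1]%classic (fun s => M k (X s) (U s)).
  apply: jensen_convex_on => // a b a01 b01.
    have -> : X ((a + b) / 2) = (X a + X b) / 2 by rewrite /X; field.
    have -> : U ((a + b) / 2) = (U a + U b) / 2 by rewrite /U; field.
    by apply: (oam_jensen hM) => //; [exact: IX|exact: IX|exact: IU|exact: IU].
  exists (Num.max (Num.max x y) (Num.max u v)) => z azb.
  have z01 : `[0, 1]%classic z by exact: (i01 a b).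
  apply: (le_trans (oam_le k (IX z z01) (IU z z01))).
  move: z01; rewrite /= in_itv/= => /andP[z0 z1].
  have seg (c d : R) : d + z * (c - d) <= Num.max c d.
    by rewrite le_max; have [cd|dc] := leP c d; apply/orP; [right|left]; nra.
  rewrite ge_max; apply/andP; split; rewrite le_max; apply/orP; [left|right]; exact: seg.
have I0 : `[0, 1]%classic (0 : R) by rewrite /= in_itv/= lexx ler01.
have I1 : `[0, 1]%classic (1 : R) by rewrite /= in_itv/= lexx ler01.
have EX : t * x + (1 - t) * y = X t by rewrite /X; ring.
have EU : t * u + (1 - t) * v = U t by rewrite /U; ring.
have E0 : (X 0, U 0) = (y, v) by rewrite /X /U !mul0r !addr0.
have E1 : (X 1, U 1) = (x, u) by rewrite /X /U; congr pair; ring.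
have := cG 0 t 1 I0 I1 t01; rewrite EX EU.
by case: E0 => -> ->; case: E1 => -> ->; rewrite !subr0 mul1r addrC.
Qed.

(** The convex function z |-> M 1 z u is continuous, and the equation of M 1 z u
    can be solved for p z when z differs from u. *)
Lemma oam_weight_continuous x : I x -> {for x, continuous p}.
Proof.
move=> Ix; have [e e0 eI] := open_nbhs_itv oI Ix.
pose u := x - e.
have Iu : I u by apply: eI; rewrite addrAC subrr add0r normrN gtr0_norm.
have ux : u < x by rewrite /u; lra.
have cM : {for x, continuous (fun z => M 1 z u)}.
  apply: (convex_on_continuous oI _ Ix) => a z b Ia Ib azb.
  have := convex_kernel_along (x := 0) (u := u) (a := 1) (b := 0) (oam_convex 1).
  by move=> /(_ a z b); rewrite /= !add0r !mulr1 !mulr0 !addr0; apply.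
have cfM : {for x, continuous (fun z => f (M 1 z u))}.
  by apply: continuous_comp cM _; apply: cf; exact: (oam_in hM).
have den z : I z -> u < z -> 0 < f z - f (M 1 z u).
  move=> Iz uz; have := oam_eq hM 1 Iz Iu; rewrite mul1r => e1.
  have fM : 0 < f (M 1 z u) - f u.
    by rewrite subr_gt0 incf//; [exact: (oam_in hM)|exact: oam_gt].
  have : p z * (f z - f (M 1 z u)) = p u * (f (M 1 z u) - f u) by lra.
  by move=> e2; rewrite -(pmulr_rgt0 _ (p0 Iz)) e2 mulr_gt0// p0.
have pE z : I z -> u < z -> p u * (f (M 1 z u) - f u) / (f z - f (M 1 z u)) = p z.
  move=> Iz uz; have d0 := den z Iz uz.
  have -> : p u * (f (M 1 z u) - f u) = p z * (f z - f (M 1 z u)).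
    by have := oam_eq hM 1 Iz Iu; rewrite mul1r => e1; lra.
  by rewrite mulfK// gt_eqF.
have : p u * (f (M 1 z u) - f u) / (f z - f (M 1 z u)) @[z --> x] --> p x.
  rewrite -(pE x Ix ux); apply: cvgM.
    by apply: cvgM; [exact: cvg_cst|apply: cvgB => //; exact: cvg_cst].
  by apply: cvgV; [rewrite gt_eqF// den|apply: cvgB => //; exact: cf].
apply: cvg_trans; apply: near_eq_cvg; near=> z; rewrite pE//.
- by near: z; exact: near_open_set.
- by near: z; exact: lt_nbhsr.
Unshelve. all: by end_near. Qed.

Lemma oam_cvg x u e : I x -> I u -> 0 < e ->
  exists N, forall k, (N <= k)%N -> `|M k x u - u| < e.
Proof.
move=> Ix Iu e0; have [d d0 dI] := open_nbhs_itv oI Iu.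
pose c := Num.min d e.
have c0 : 0 < c by rewrite lt_min d0.
have Ir : I (u + c) by apply: dI; rewrite addrAC subrr add0r gtr0_norm// ge_min lexx.
have Il : I (u - c) by apply: dI; rewrite addrAC subrr add0r normrN gtr0_norm// ge_min lexx.
pose h := Num.min (f (u + c) - f u) (f u - f (u - c)).
have h0 : 0 < h by rewrite lt_min !subr_gt0 !incf//; lra.
pose D := p x * (f x - f u).
have pu := p0 Iu; have px := p0 Ix.
exists (Num.truncn (`|D| / (h * p u))).+1 => k Nk.
have kD : `|D| < h * (p x + k%:R * p u).
  have : `|D| / (h * p u) < k%:R.
    by apply: (lt_le_trans (truncnS_gt _)); rewrite ler_nat.
  rewrite ltr_pdivrMr ?mulr_gt0// => kD; apply: (lt_le_trans kD).
  by rewrite mulrDr mulrCA ler_wpDl// ltW// mulr_gt0.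
have IM := oam_in hM k Ix Iu.
have : `|f (M k x u) - f u| < h.
  rewrite -(ltr_pM2l (weight_gt0 k Ix Iu)) -{1}(gtr0_norm (weight_gt0 k Ix Iu)).
  by rewrite -normrM (oam_eq hM)// (mulrC _ h).
rewrite ltr_norml !lt_min => /andP[+ /andP[fr _]].
rewrite ltrNl lt_min => /andP[_ fl].
have Mr : M k x u < u + c by rewrite -(increasing_on_ltE incf IM Ir); lra.
have Ml : u - c < M k x u by rewrite -(increasing_on_ltE incf Il IM); lra.
have ce : c <= e by rewrite ge_min lexx orbT.
by rewrite ltr_norml; apply/andP; split; lra.
Qed.

(** The point (x, u) is the midpoint of (s + 2 (x - u), s) and of a diagonal point
    (w, w), so if k (M k x u - u) were unbounded in k, it would be so at every s to
    the right of u, with the same distance 2 (x - u).  Then f would have short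
    steps of arbitrarily small slope all over [u, u + r] and be constant there. *)
Lemma oam_bounded u x r : I u -> u < x -> I x -> 0 < r ->
  (forall s, u <= s <= u + r -> I s) ->
  (forall s, u <= s < u + r -> I (s + 2 * (x - u)) /\ I (2 * u - s)) ->
  exists C, forall k, k%:R * (M k x u - u) <= C.
Proof.
move=> Iu ux Ix r0 Ir Is; apply: contrapT => unb.
have {}unb C : exists k, C < k%:R * (M k x u - u).
  apply: contrapT => bC; apply: unb; exists C => k.
  by rewrite leNgt; apply/negP => h; apply: bC; exists k.
(* Half the average slope on [u, u + r]: steps of this slope are too flat. *)
pose h := (f (u + r) - f u) / (2 * r).
have Iur : I (u + r) by apply: Ir; rewrite lexx andbT; lra.
have fur : 0 < f (u + r) - f u by rewrite subr_gt0 incf//; lra.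
have h0 : 0 < h by rewrite divr_gt0// mulr_gt0.
suff : f (u + r) - f u <= h * (u + r - u).
  have -> : h * (u + r - u) = (f (u + r) - f u) / 2 by rewrite /h; field; lra.
  lra.
apply: small_steps_le => [||s e sur e0]; first lra.
  by move=> s /Ir; exact: cf.
have Iss : I s by apply: Ir; case/andP: sur => -> /ltW.
have [Ix' Iw] := Is s sur; set x' := s + _ in Ix'; set w := 2 * u - s in Iw.
have sx' : s < x' by rewrite /x'; lra.
have [N NP] := oam_cvg Ix' Iss e0.
pose D := p x' * (f x' - f s).
have D0 : 0 < D by rewrite mulr_gt0 ?p0// subr_gt0 incf.
(* The first term makes the step at s flat enough; the second forces N <= k. *)
pose C := D / (2 * h * p s) + N%:R * (x - u).
have [k kC] := unb C.
have k0 : 0 <= k%:R :> R by [].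
have Mx : M k x u <= x by have := oam_le k Ix Iu; rewrite max_l// ltW.
have ps := p0 Iss.
have hps : 0 < 2 * h * p s by apply: mulr_gt0 => //; apply: mulr_gt0.
have DC : 0 < D / (2 * h * p s) by rewrite divr_gt0.
have Nk : (N <= k)%N.
  rewrite -(ler_nat R) -(ler_pM2r (_ : 0 < x - u)) ?subr_gt0//.
  have : k%:R * (M k x u - u) <= k%:R * (x - u) by rewrite ler_wpM2l// lerD2r.
  by rewrite /C in kC; lra.
have kC' : D < k%:R * (M k x u - u) * (2 * h * p s).
  rewrite -ltr_pdivrMr//; apply: le_lt_trans kC.
  by rewrite lerDl mulr_ge0// subr_ge0 ltW.
have Ms := oam_gt k Ix' Iss sx'.
exists (M k x' s - s); split.
- by rewrite subr_gt0.
- by have := NP k Nk; rewrite gtr0_norm// subr_gt0.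
rewrite (addrC s) subrK -(ler_pM2l (weight_gt0 k Ix' Iss)) (oam_eq hM)// -/D.
have := oam_jensen hM k Ix' Iw Iss Iw; rewrite oam_id//.
have -> : (x' + w) / 2 = x by rewrite /x' /w; field.
have -> : (s + w) / 2 = u by rewrite /w; field.
move=> Mmid; have half : M k x u - u <= (M k x' s - s) / 2 by rewrite /w in Mmid; lra.
have khp := mulr_ge0 k0 (ltW hps).
have : k%:R * (M k x u - u) * (2 * h * p s) <= k%:R * (M k x' s - s) * (h * p s).
  have := ler_wpM2l khp half.
  have -> : k%:R * (2 * h * p s) * ((M k x' s - s) / 2) =
    k%:R * (M k x' s - s) * (h * p s) by field.
  lra.
have Ms0 : 0 <= M k x' s - s by rewrite subr_ge0 ltW.
have := mulr_ge0 (ltW (p0 Ix')) (mulr_ge0 (ltW h0) Ms0).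
lra.
Qed.

(** The converse transport: (s + (x - u) / 2, s) is the midpoint of (x, u) and of
    a diagonal point.  If k (M k x u - u) came close to 0, then f would have
    arbitrarily steep short steps all over [u, u + r]. *)
Lemma oam_bounded_below u x r : I u -> u < x -> I x -> 0 < r ->
  (forall s, u <= s <= u + r -> I s) ->
  (forall s, u <= s < u + r -> I (s + (x - u) / 2) /\ I (2 * s - u)) ->
  exists2 c, 0 < c & exists N, forall k, (N <= k)%N -> c <= k%:R * (M k x u - u).
Proof.
move=> Iu ux Ix r0 Ir Is; apply: contrapT => unb.
have {}unb c N : 0 < c -> exists2 k, (N <= k)%N & k%:R * (M k x u - u) < c.
  move=> c0; apply: contrapT => bc; apply: unb; exists c => //; exists N => k Nk.
  by rewrite leNgt; apply/negP => h; apply: bc; exists k.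
(* Twice the average slope on [u, u + r]: steps of this slope are too steep. *)
pose m := 2 * (f (u + r) - f u) / r.
have Iur : I (u + r) by apply: Ir; rewrite lexx andbT; lra.
have fur : 0 < f (u + r) - f u by rewrite subr_gt0 incf//; lra.
have m0 : 0 < m by rewrite divr_gt0// mulr_gt0.
suff : m * (u + r - u) <= f (u + r) - f u.
  have -> : m * (u + r - u) = 2 * (f (u + r) - f u) by rewrite /m; field; lra.
  lra.
apply: small_steps_ge => [||s e sur e0]; first lra.
  by move=> s /Ir; exact: cf.
have Iss : I s by apply: Ir; case/andP: sur => -> /ltW.
have [Ix' Iw] := Is s sur; set x' := s + _ in Ix'; set w := 2 * s - u in Iw.
have sx' : s < x' by rewrite /x'; lra.
have [N NP] := oam_cvg Ix' Iss e0.
pose D := p x' * (f x' - f s).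
have D0 : 0 < D by rewrite mulr_gt0 ?p0// subr_gt0 incf.
have ps := p0 Iss; have px' := p0 Ix'.
(* Whenever k (M k x u - u) < c, the step at s has slope at least m, as 1 <= k. *)
pose c := 2 * D / (m * (p x' + p s)).
have mpp : 0 < m * (p x' + p s) by apply: mulr_gt0 => //; exact: addr_gt0.
have c0 : 0 < c by apply: divr_gt0 => //; exact: mulr_gt0.
have [k Nk kc] := unb c N.+1 c0.
have k1 : 1 <= k%:R :> R by rewrite ler1n (leq_trans _ Nk).
have Ms := oam_gt k Ix' Iss sx'.
exists (M k x' s - s); split.
- by rewrite subr_gt0.
- by have := NP k (ltnW Nk); rewrite gtr0_norm// subr_gt0.
rewrite (addrC s) subrK -(ler_pM2l (weight_gt0 k Ix' Iss)) (oam_eq hM)// -/D.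
have := oam_jensen hM k Ix Iw Iu Iw; rewrite oam_id//.
have -> : (x + w) / 2 = x' by rewrite /x' /w; field.
have -> : (u + w) / 2 = s by rewrite /w; field.
move=> Mmid; have half : 2 * (M k x' s - s) <= M k x u - u by rewrite /w in Mmid; lra.
have kd : k%:R * (M k x' s - s) * (m * (p x' + p s)) <= D.
  have : k%:R * (2 * (M k x' s - s)) <= c.
    by apply: le_trans (ltW kc); rewrite ler_wpM2l// (le_trans ler01).
  rewrite /c ler_pdivlMr//; lra.
apply: le_trans kd.
have -> : k%:R * (M k x' s - s) * (m * (p x' + p s)) =
  (p x' + k%:R * p s) * (m * (M k x' s - s))
  + (k%:R - 1) * p x' * (m * (M k x' s - s)) by ring.
rewrite lerDl; apply: mulr_ge0; first by rewrite mulr_ge0 ?subr_ge0// ltW.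
by apply: mulr_ge0; [exact: ltW|rewrite subr_ge0 ltW].
Qed.

(** With x fixed to the right of u0, the derivative near u0 is
    c u = p x (f x - f u) / (p u L u), where L u = limsup_k k (M k x u - u). *)
Lemma oam_locally_smooth u0 : I u0 -> exists J c,
  [/\ open J, J u0, (forall u, J u -> is_derive u 1 f (c u)),
      (forall u, J u -> {for u, continuous c}) & forall u, J u -> 0 < c u].
Proof.
move=> Iu0; have [e e0 eI] := open_nbhs_itv oI Iu0.
(* With |u - u0| < r and x = u0 + 2 r, the points used by the two transport
   arguments stay within 8 r of u0. *)
pose r := e / 8; have r0 : 0 < r by rewrite /r; lra.
have {}eI z : u0 - 8 * r <= z <= u0 + 8 * r -> I z.
  by move=> /andP[z1 z2]; apply: eI; rewrite ler_norml /r in z1 z2 *; apply/andP; split; lra.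
pose x := u0 + 2 * r; have Ix : I x by apply: eI; apply/andP; split; rewrite /x; lra.
pose J := [set u | u0 - r < u < u0 + r].
have oJ : open J.
  have -> : J = `]u0 - r, u0 + r[%classic by apply/seteqP; split=> z; rewrite /J/= in_itv.
  exact: interval_open.
have JI : J `<=` I by move=> z /andP[z1 z2]; apply: eI; apply/andP; split; lra.
have Jx u : J u -> u < x by move=> /andP[z1 z2]; rewrite /x; lra.
have superior u : J u -> exists L, [/\ 0 < L,
    (forall e, 0 < e -> exists N, forall k, (N <= k)%N -> k%:R * (M k x u - u) <= L + e) &
    (forall e N, 0 < e -> exists2 k, (N <= k)%N & L - e <= k%:R * (M k x u - u))].
  move=> Ju; have Iu := JI u Ju; have ux := Jx u Ju; have /andP[u1 u2] := Ju.
  have Ir s : u <= s <= u + r -> I s.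
    by move=> /andP[s1 s2]; apply: eI; apply/andP; split; lra.
  have [|C CP] := oam_bounded Iu ux Ix r0 Ir.
    by move=> s /andP[s1 s2]; split; apply: eI; apply/andP; split; rewrite /x; lra.
  have [|c c0 [N NP]] := oam_bounded_below Iu ux Ix r0 Ir.
    by move=> s /andP[s1 s2]; split; apply: eI; apply/andP; split; rewrite /x; lra.
  have [k|L [Lup Llo]] := @limit_superior R (fun k => k%:R * (M k x u - u)) C.
    by rewrite CP mulr_ge0// subr_ge0 ltW// oam_gt.
  exists L; split => //; have c20 : 0 < c / 2 by lra.
  have [N' N'P] := Lup _ c20.
  have := N'P (maxn N N') (leq_maxr _ _); have := NP (maxn N N') (leq_maxl _ _); lra.
have [L LP] : exists L : R -> R, forall u, J u -> [/\ 0 < L u,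
    (forall e, 0 < e -> exists N, forall k, (N <= k)%N -> k%:R * (M k x u - u) <= L u + e) &
    (forall e N, 0 < e -> exists2 k, (N <= k)%N & L u - e <= k%:R * (M k x u - u))].
  pose L u := if pselect (J u) is left Ju then projT1 (cid (superior u Ju)) else 0.
  by exists L => u Ju; rewrite /L; case: pselect => // Ju'; case: cid.
have cL : forall u, J u -> {for u, continuous L}.
  apply: convex_on_continuous => // a z b Ja Jb azb.
  have [/andP[a1 a2] /andP[b1 b2]] := (Ja, Jb); have [az zb] := andP azb.
  have Jz : J z by apply/andP; split; lra.
  have [_ La _] := LP a Ja; have [_ Lb _] := LP b Jb; have [_ _ Lz] := LP z Jz.
  apply/ler_addgt0Pr => d d0.
  (* The errors d' enter with total weight 2 (b - a). *)
  pose d' := d / (2 * (b - a) + 1).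
  have ba0 : 0 <= b - a by lra.
  have d'0 : 0 < d' by rewrite divr_gt0// ltr_wpDl// mulr_ge0.
  have [Na NaP] := La d' d'0; have [Nb NbP] := Lb d' d'0.
  have [k Nk Lk] := Lz d' (maxn Na Nb) d'0.
  have {NaP} ha := NaP k (leq_trans (leq_maxl _ _) Nk).
  have {NbP} hb := NbP k (leq_trans (leq_maxr _ _) Nk).
  have := convex_kernel_along (x := x) (u := 0) (a := 0) (b := 1) (oam_convex k).
  move=> /(_ a z b); rewrite /= !add0r !mulr1 !mulr0 !addr0.
  move=> /(_ (conj Ix (JI a Ja)) (conj Ix (JI b Jb)) azb) cvx.
  have k0 : 0 <= k%:R :> R by [].
  have {}cvx : (b - a) * (k%:R * (M k x z - z)) <=
      (b - z) * (k%:R * (M k x a - a)) + (z - a) * (k%:R * (M k x b - b)).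
    have := ler_wpM2l k0 cvx; lra.
  have dE : d' * (2 * (b - a)) <= d.
    rewrite /d' mulrAC ler_pdivrMr ?ltr_wpDl ?mulr_ge0//; nra.
  have h1 : (b - a) * (L z - d') <= (b - a) * (k%:R * (M k x z - z)) by rewrite ler_wpM2l.
  have h2 : (b - z) * (k%:R * (M k x a - a)) <= (b - z) * (L a + d').
    by rewrite ler_wpM2l ?subr_ge0.
  have h3 : (z - a) * (k%:R * (M k x b - b)) <= (z - a) * (L b + d').
    by rewrite ler_wpM2l ?subr_ge0.
  lra.
pose c u := p x * (f x - f u) / (p u * L u).
have cp := oam_weight_continuous.
have pL0 u : J u -> 0 < p u * L u.
  by move=> Ju; have [L0 _ _] := LP u Ju; rewrite mulr_gt0// p0//; exact: JI.
have D0 u : J u -> 0 < p x * (f x - f u).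
  by move=> Ju; rewrite mulr_gt0 ?p0// subr_gt0 incf//; [exact: JI|exact: Jx].
have c0 u : J u -> 0 < c u by move=> Ju; rewrite divr_gt0 ?pL0 ?D0.
have cc u : J u -> {for u, continuous c}.
  move=> Ju; apply: cvgM.
    by apply: cvgM; [exact: cvg_cst|apply: cvgB; [exact: cvg_cst|exact: cf (JI u Ju)]].
  apply: cvgV; first by rewrite gt_eqF// pL0.
  by apply: cvgM; [exact: cp (JI u Ju)|exact: cL].
exists J, c; split=> //; first by apply/andP; split; lra.
have step u k : J u -> (p x + k%:R * p u) * (f (u + (M k x u - u)) - f u) = c u * (p u * L u).
  move=> Ju; rewrite (addrC u) subrK (oam_eq hM)//; last exact: JI.
  by rewrite /c divfK// gt_eqF// pL0.
apply: small_steps_derivative => // [u /JI|u m d Ju cm d0|u m d Ju mc d0]; first exact: cf.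
  have Iu := JI u Ju; have [Lu0 _ Lo] := LP u Ju.
  have m0 : 0 < m := lt_trans (c0 u Ju) cm.
  have [N NP] := oam_cvg Ix Iu d0.
  have e'0 : 0 < L u * (m - c u) / m by rewrite divr_gt0// mulr_gt0// subr_gt0.
  have [k Nk kL] := Lo _ N e'0.
  have Mu := oam_gt k Ix Iu (Jx u Ju).
  exists (M k x u - u); split; first by rewrite subr_gt0.
    by have := NP k Nk; rewrite gtr0_norm// subr_gt0.
  rewrite -(ler_pM2l (weight_gt0 k Ix Iu)) step//.
  have : c u * L u <= m * (k%:R * (M k x u - u)).
    have := ler_wpM2l (ltW m0) kL.
    by rewrite (_ : m * (L u - L u * (m - c u) / m) = c u * L u); [|field; lra].
  move=> h; have := ler_wpM2r (ltW (p0 Iu)) h.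
  have : 0 <= p x * (m * (M k x u - u)) by rewrite !mulr_ge0 ?subr_ge0 ?ltW ?p0.
  lra.
have Iu := JI u Ju; have [Lu0 Up _] := LP u Ju.
have [N NP] := oam_cvg Ix Iu d0.
have [m0|m0] := leP m 0.
  have Mu := oam_gt N Ix Iu (Jx u Ju).
  exists (M N x u - u); split; first by rewrite subr_gt0.
    by have := NP N (leqnn N); rewrite gtr0_norm// subr_gt0.
  apply: (@le_trans _ _ 0); first by rewrite mulr_le0_ge0// subr_ge0 ltW.
  rewrite (addrC u) subrK subr_ge0 ltW// incf//; exact: (oam_in hM).
(* With this e', m (L u + e') is halfway between m L u and c u L u, and k is
   chosen so large that the term p x of the weight p x + k p u fits the gap. *)
pose e' := L u * (c u - m) / (2 * m).
have e'0 : 0 < e' by rewrite divr_gt0 ?mulr_gt0// subr_gt0.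
have [N' N'P] := Up _ e'0.
pose h := p u * (L u * (c u - m) / 2).
have h0 : 0 < h by rewrite mulr_gt0 ?p0// divr_gt0 ?mulr_gt0// subr_gt0.
pose k := maxn (maxn N N') (Num.truncn (m * (L u + e') * p x / h)).+1.
have Nk : (N <= k)%N by rewrite /k !leq_max leqnn.
have N'k : (N' <= k)%N by rewrite /k !leq_max leqnn orbT.
have kh : m * (L u + e') * p x <= k%:R * h.
  rewrite -ler_pdivrMr//; apply/ltW/(lt_le_trans (truncnS_gt _)).
  by rewrite ler_nat /k leq_max leqnn orbT.
have Mu := oam_gt k Ix Iu (Jx u Ju).
have k1 : 1 <= k%:R :> R by rewrite ler1n /k leq_max orbT.
exists (M k x u - u); split; first by rewrite subr_gt0.
  by have := NP k Nk; rewrite gtr0_norm// subr_gt0.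
rewrite -(ler_pM2l (weight_gt0 k Ix Iu)) step//.
have kpos : 0 < k%:R :> R by apply: lt_le_trans k1.
rewrite -(ler_pM2l kpos).
have := N'P k N'k => kL.
have w0 := weight_gt0 k Ix Iu.
have : m * (p x + k%:R * p u) * (k%:R * (M k x u - u)) <= m * (p x + k%:R * p u) * (L u + e').
  by rewrite ler_wpM2l// mulr_ge0// ltW.
have : m * (k%:R * p u) * (L u + e') = k%:R * (c u * (p u * L u)) - k%:R * h.
  by rewrite /e' /h; field; lra.
lra.
Qed.

End OneAgainstMany.

Lemma bajraktarevic_one_against_many (R : realType) (I : set R) (f p : R -> R) :
  is_interval I -> strictly_monotone I f -> {within I, continuous f} ->
  (forall x, I x -> 0 < p x) ->
  jensen_convex_mean I (bajraktarevic_mean I f p) ->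
  one_against_many_mean I f p (fun k x u => bajraktarevic_mean I f p
    (\row_(i < k.+1) if i == ord0 then x else u)).
Proof.
move=> iI mf cf p0 JM.
pose rw k (x u : R) := \row_(i < k.+1) if i == ord0 then x else u.
have Irw k x u : I x -> I u -> forall i, I (rw k x u ord0 i).
  by move=> Ix Iu i; rewrite mxE; case: ifP.
split=> [k x u Ix Iu|k x u Ix Iu|k x y u v Ix Iy Iu Iv].
- by have [] := bajraktarevic_meanP iI mf cf p0 (ltn0Sn k) (Irw k x u Ix Iu).
- have [_] := bajraktarevic_meanP iI mf cf p0 (ltn0Sn k) (Irw k x u Ix Iu).
  rewrite big_ord_recl /= -/(rw k x u); set m := bajraktarevic_mean _ _ _ _.
  rewrite (eq_bigr (fun=> p u * (f u - f m))) => [|i _]; last by rewrite !mxE.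
  by rewrite sumr_const card_ord mxE/= -mulr_natl => e; lra.
- have := JM k.+1 (rw k x u) (rw k y v) (ltn0Sn k) (Irw k x u Ix Iu) (Irw k y v Iy Iv).
  suff -> : 2^-1 *: (rw k x u + rw k y v) = rw k ((x + y) / 2) ((u + v) / 2) by [].
  by apply/rowP => i; rewrite !mxE; case: ifP => _; rewrite mulrC.
Qed.

Lemma one_against_many_opp (R : realType) (I : set R) (f p : R -> R)
    (M : nat -> R -> R -> R) :
  one_against_many_mean I f p M -> one_against_many_mean I (fun z => - f z) p M.
Proof.
move=> hM; split=> [|k x u Ix Iu|]; [exact: (oam_in hM)| |exact: (oam_jensen hM)].
by have := oam_eq hM k Ix Iu => e; lra.
Qed.

(** The equation of M k x u reads (p x / k + p u) k (f (M k x u) - f u) =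
    p x (f x - f u), and f (M k x u) - f u is asymptotic to f' u (M k x u - u). *)
Lemma one_against_many_cvg_kernel (R : realType) (I : set R) (f p : R -> R)
    (M : nat -> R -> R -> R) (x u : R) :
  one_against_many_mean I f p M -> I x -> I u -> p u != 0 ->
  derivable f u 1 -> derive1 f u != 0 -> M n.+1 x u @[n --> \oo] --> u ->
  n.+1%:R * (M n.+1 x u - u) @[n --> \oo] --> bajraktarevic_kernel f p x u.
Proof.
move=> hM Ix Iu pu df f'0 Mu.
have [g [gE cg gu]] := (is_derive1_caratheodory _ _ _).1 (derivable_is_derive df).
have gM : g (M n.+1 x u) @[n --> \oo] --> derive1 f u.
  by rewrite -gu; exact: cvg_comp Mu cg.
have pn : p x * n.+1%:R^-1 + p u @[n --> \oo] --> p u.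
  rewrite -[X in _ --> X]add0r; apply: cvgD; last exact: cvg_cst.
  by rewrite -[X in _ --> X](mulr0 (p x)); apply: cvgM; [exact: cvg_cst|exact: cvg_harmonic].
have den0 : p u * derive1 f u != 0 by rewrite mulf_neq0.
have den : (p x * n.+1%:R^-1 + p u) * g (M n.+1 x u) @[n --> \oo] --> p u * derive1 f u.
  exact: cvgM.
have nden : \forall n \near \oo, (p x * n.+1%:R^-1 + p u) * g (M n.+1 x u) != 0.
  by have /cvgr_neq0 := den; apply.
have : p x * (f x - f u) / ((p x * n.+1%:R^-1 + p u) * g (M n.+1 x u)) @[n --> \oo]
    --> bajraktarevic_kernel f p x u.
  by apply: cvgM; [exact: cvg_cst|exact: cvgV].
apply: cvg_trans; apply: near_eq_cvg; near=> n.
have d0 : (p x * n.+1%:R^-1 + p u) * g (M n.+1 x u) != 0 by near: n.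
have n0 : n.+1%:R != 0 :> R by rewrite pnatr_eq0.
rewrite -(oam_eq hM n.+1 Ix Iu) gE.
apply: (mulIf d0); rewrite divfK//.
have -> : p x + n.+1%:R * p u = n.+1%:R * (p x * n.+1%:R^-1 + p u) by field.
ring.
Unshelve. all: by end_near. Qed.

(** When f is decreasing, regularity comes from its opposite, which has the same
    means; the limit that yields the convexity of the kernel is insensitive to
    monotonicity. *)
Lemma jensen_mean_convex_kernel (R : realType) (I : set R) (f p : R -> R) :
  open I -> is_interval I -> strictly_monotone I f -> {within I, continuous f} ->
  (forall x, I x -> 0 < p x) ->
  jensen_convex_mean I (bajraktarevic_mean I f p) ->
  Ck_sharp I 1 f /\ @convex_function R (R^o * R^o)%type (I `*` I)
      (fun z => bajraktarevic_kernel f p z.1 z.2).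
Proof.
move=> oI iI mf cf p0 JM.
have hM := bajraktarevic_one_against_many iI mf cf p0 JM.
set M := fun k x u => _ in hM.
have {}cf x : I x -> {for x, continuous f}.
  by move: cf; rewrite continuous_open_subspace// => cf Ix; apply: cf; rewrite inE.
have [smooth cM Mu] : [/\ forall u0, I u0 -> exists J c, [/\ open J, J u0,
      (forall u, J u -> is_derive u 1 f (c u)),
      (forall u, J u -> {for u, continuous c}) & forall u, J u -> c u != 0],
    forall k, @convex_function R (R^o * R^o)%type (I `*` I) (fun z => M k z.1 z.2) &
    forall x u e, I x -> I u -> 0 < e ->
      exists N, forall k, (N <= k)%N -> `|M k x u - u| < e].
  case: mf => [incf|decf].
    have {}incf : increasing_on I f by move=> x y Ix Iy; apply: incf; rewrite inE.
    split=> [u0 Iu0|k|x u e Ix Iu]; last exact: oam_cvg hM _ _ _ Ix Iu.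
      have [J [c [oJ Ju dJ cc c0]]] := oam_locally_smooth oI iI incf cf p0 hM Iu0.
      by exists J, c; split => // u /c0; rewrite lt0r => /andP[].
    exact: (oam_convex iI incf p0 hM).
  have incf : increasing_on I (fun z => - f z).
    by move=> x y Ix Iy xy; rewrite ltrN2; apply: decf; rewrite ?inE.
  have cNf x : I x -> {for x, continuous (fun z => - f z)} by move=> /cf; exact: cvgN.
  have hN := one_against_many_opp hM.
  split=> [u0 Iu0|k|x u e Ix Iu].
  - have [J [c [oJ Ju dJ cc c0]]] := oam_locally_smooth oI iI incf cNf p0 hN Iu0.
    exists J, (fun z => - c z).
    split; [exact: oJ|exact: Ju|move=> u Jz|move=> u Jz|move=> u /c0].
    + have := is_deriveN (dJ u Jz); congr is_derive.
      by apply/funext => z; rewrite fctE opprK.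
    + by apply: cvgN; exact: cc.
    + by rewrite oppr_eq0 lt0r => /andP[].
  - exact: (oam_convex iI incf p0 hN).
  - exact: (oam_cvg oI incf p0 hN).
have df u : I u -> derivable f u 1.
  by move=> /smooth[J [c [_ Ju /(_ _ Ju)[]]]].
have f'0 u : I u -> derive1 f u != 0.
  by move=> /smooth[J [c [_ Ju dJ _ /(_ _ Ju)]]]; rewrite (is_derive_derive1 (dJ u Ju)).
split.
  split; last exact: f'0.
  apply/Ck1P => // u Iu; split; first exact: df.
  have [J [c [oJ Ju dJ cc _]]] := smooth u Iu.
  have : c z @[z --> u] --> derive1 f u.
    by rewrite (is_derive_derive1 (dJ u Ju)); exact: cc.
  apply: cvg_trans; apply: near_eq_cvg; near=> z.
  have Jz : J z by near: z; exact: near_open_set.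
  by rewrite (is_derive_derive1 (dJ z Jz)).
have lim x u : I x -> I u ->
    n.+1%:R * (M n.+1 x u - u) @[n --> \oo] --> bajraktarevic_kernel f p x u.
  move=> Ix Iu; have pu : p u != 0 by rewrite gt_eqF// p0.
  apply: (one_against_many_cvg_kernel hM Ix Iu pu (df u Iu) (f'0 u Iu)).
  apply/cvgrPdist_lt => e e0; have [N NP] := Mu x u e Ix Iu e0.
  near=> n; rewrite distrC NP//; apply: leqW; near: n.
  exact: nbhs_infty_ge.
apply/convex_kernelP => t x y u v t01 Ix Iy Iu Iv.
have /andP[t0 t1] := t01.
have mix a b : I a -> I b -> I (t * a + (1 - t) * b).
  move=> Ia Ib; have -> : t * a + (1 - t) * b = b + t * (a - b) by ring.
  exact: interval_segment.
have L := lim _ _ (mix _ _ Ix Iy) (mix _ _ Iu Iv).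
have Rhs : t * (n.+1%:R * (M n.+1 x u - u)) + (1 - t) * (n.+1%:R * (M n.+1 y v - v))
    @[n --> \oo] --> t * bajraktarevic_kernel f p x u + (1 - t) * bajraktarevic_kernel f p y v.
  by apply: cvgD; apply: cvgM; [exact: cvg_cst|exact: lim|exact: cvg_cst|exact: lim].
apply: (ler_cvg_to L Rhs); near=> n.
have := (convex_kernelP I (M n.+1)).1 (cM n.+1) t x y u v t01 Ix Iy Iu Iv.
have n0 : 0 <= n.+1%:R :> R by [].
move=> /(ler_wpM2l n0) h /=; lra.
Unshelve. all: by end_near. Qed.

(** * The equivalences *)

Unset Implicit Arguments.
Set Strict Implicit.

Theorem theorem3p1 (R : realType) (I : set R) (f p : R -> R)
    (I_neq0 : I !=set0) (I_open : open I) (I_itv : is_interval I)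
    (f_mono : {in I &, {homo f : x y / x < y}} \/
              {in I &, {homo f : x y /~ x < y}})
    (f_cont : {within I, continuous f})
    (p_gt0 : forall x, I x -> 0 < p x) :
  [<->
    (* (i) *)
    jensen_convex_mean I (bajraktarevic_mean I f p);
    (* (ii) *)
    Ck_sharp I 1 f /\
    @convex_function R (R^o * R^o)%type (I `*` I)
      (fun z => bajraktarevic_kernel f p z.1 z.2);
    (* (iii) *)
    [/\ Ck_sharp I 2 f, Ck I 1 p &
      forall x y u v, I x -> I y -> I u -> I v ->
        p y * (f y - f v) / (p v * derive1 f v) >=
          p x * (f x - f u) / (p u * derive1 f u)
          + (derive1 (p \* f) x - f u * derive1 p x) / ((p \* derive1 f) u) * (y - x)
          + p x * (((f u - f x) * derive1 (p \* derive1 f) u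
                    - (p \* derive1 f) u * derive1 f u) / (p \* derive1 f) u ^+ 2)
            * (v - u)];
    (* (iv) *)
    [/\ Ck_sharp I 2 f, Ck I 1 p &
      forall x y u v, I x -> I y -> I u -> I v ->
        ((derive1 (p \* f) x - f u * derive1 p x) / ((p \* derive1 f) u)
         - (derive1 (p \* f) y - f v * derive1 p y) / ((p \* derive1 f) v)) * (x - y)
        + (p x * (((f u - f x) * derive1 (p \* derive1 f) u
                   - (p \* derive1 f) u * derive1 f u) / (p \* derive1 f) u ^+ 2)
           - p y * (((f v - f y) * derive1 (p \* derive1 f) v
                     - (p \* derive1 f) v * derive1 f v) / (p \* derive1 f) v ^+ 2))
          * (u - v) >= 0]].
Proof.
have mf : strictly_monotone I f := f_mono.
have regular : Ck_sharp I 2 f -> Ck I 1 p ->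
    [/\ forall x, I x -> derivable f x 1, forall x, I x -> derivable p x 1,
        forall x, I x -> derivable (derive1 f) x 1 & forall x, I x -> derive1 f x != 0].
  move=> [/(Ck2P f I_open) C2 f'0] /(Ck1P p I_open) C1.
  split; [move=> x Ix; have [dfx _ _] := C2 x Ix; exact: dfx|exact: (fun x Ix => (C1 x Ix).1)
    |move=> x Ix; have [_ d2fx _] := C2 x Ix; exact: d2fx|exact: f'0].
tfae.
- exact: jensen_mean_convex_kernel.
- move=> [C1f cB].
  have [C2f C1p] := convex_kernel_smooth I_open I_itv mf p_gt0 C1f cB.
  have [df dp d2f f'0] := regular C2f C1p.
  split=> [||x y u v Ix Iy Iu Iv]; [exact: C2f|exact: C1p|].
  exact: (convex_kernel_gradient I_open p_gt0 df dp d2f f'0 cB Ix Iy Iu Iv).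
- move=> [C2f C1p grad]; split=> [||x y u v Ix Iy Iu Iv]; [exact: C2f|exact: C1p|].
  have a : bajraktarevic_kernel f p x u + kernel_dx f p x u * (y - x)
      + kernel_du f p x u * (v - u) <= bajraktarevic_kernel f p y v.
    exact: grad.
  have b : bajraktarevic_kernel f p y v + kernel_dx f p y v * (x - y)
      + kernel_du f p y v * (u - v) <= bajraktarevic_kernel f p x u.
    exact: grad.
  suff : 0 <= (kernel_dx f p x u - kernel_dx f p y v) * (x - y)
      + (kernel_du f p x u - kernel_du f p y v) * (u - v) by [].
  lra.
- move=> [C2f C1p mono]; have [df dp d2f f'0] := regular C2f C1p.
  apply: jensen_kernel_mean => //.
  exact: gradient_monotone_jensen.
Qed.
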